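(* Let $n\ge 2$, let $u\in S^{n-1}$, $H=u^\perp$, let $\diamondsuit:\mathcal{K}^n_n\to\mathcal{L}^n$, and let $\varphi:\mathbb{R}\to\mathbb{R}$ be a contraction. The following are equivalent. (i) $\diamondsuit$ is monotonic, measure preserving, respects $H$-cylinders, and maps balls to balls, and $\varphi$ coincides with the function $\varphi_\diamondsuit$ associated with $\diamondsuit$, i.e., $\diamondsuit B(x+tu,r)=B(x+\varphi(t)u,r)$, essentially, for all $r>0$, $x\in H$, and $t\in\mathbb{R}$. (ii) For each $K\in\mathcal{K}^n_n$, $$\diamondsuit K=\bigcup_{t\in\mathbb{R}}\operatorname{int}\,(K_t+\varphi(t)u),$$ essentially, where $K_t=(K-tu)\cap(K^\dagger+tu)$. (iii) For each $K\in\mathcal{K}^n_n$ and $\mathcal{H}^{n-1}$-almost all $x\in H$, $$(\diamondsuit K)\cap(H^\perp+x)=(K\cap(H^\perp+x))+(\varphi(t_x)-t_x)u,$$ up to a set of $\mathcal{H}^1$-measure zero, where $x+t_xu$ is the midpoint of $K\cap(H^\perp+x)$.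
   Context: $\mathcal{H}^k$ is $k$-dimensional Hausdorff measure in $\mathbb{R}^n$; ''essentially'' means up to a set of $\mathcal{H}^n$-measure zero. $\mathcal{L}^n$ is the class of $\mathcal{H}^n$-measurable sets of finite $\mathcal{H}^n$-measure in $\mathbb{R}^n$; $\mathcal{K}^n_n$ is the class of convex bodies (compact convex sets with nonempty interior). $S^{n-1}$ is the unit sphere, $u^\perp$ is the hyperplane through the origin orthogonal to $u$, $H^\perp$ is the line spanned by $u$. $B(x,r)$ is the closed ball with center $x$ and radius $r$; ''ball'' means closed $n$-dimensional ball (positive radius). $K^\dagger$ is the reflection of $K$ in $H$. A contraction is a Lipschitz function with Lipschitz constant $1$. In (iii), when $K\cap(H^\perp+x)=\emptyset$ the right-hand side is the empty set. Properties of $\diamondsuit:\mathcal{E}\subset\mathcal{L}^n\to\mathcal{L}^n$, required for all $K,L\in\mathcal{E}$, with sets of $\mathcal{H}^n$-measure zero ignored in all inclusions and equalities of sets: - monotonic: $K\subset L\Rightarrow\diamondsuit K\subset\diamondsuit L$; - measure preserving: $\mathcal{H}^n(\diamondsuit K)=\mathcal{H}^n(K)$; - respects $H$-cylinders: if $K\subset(B(x,r)\cap H)+H^\perp$, then $\diamondsuit K\subset(B(x,r)\cap H)+H^\perp$ (for all $x\in\mathbb{R}^n$, $r>0$); - maps balls to balls: if $K=B(x,r)$, then $\diamondsuit K=B(x',r')$ for some $x'$ and $r'$. If $\diamondsuit$ is monotonic, respects $H$-cylinders, and maps balls to balls, then $\varphi_\diamondsuit:\mathbb{R}\to\mathbb{R}$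 denotes the (unique, existing) contraction with $\diamondsuit B(x+tu,r)=B(x+\varphi_\diamondsuit(t)u,r)$, essentially, for all $r>0$, $x\in H$, $t\in\mathbb{R}$. *)

(* Defs.v *)
From mathcomp Require Import all_boot all_order all_algebra.
From mathcomp Require Import all_classical all_reals all_analysis.
Import Order.TTheory GRing.Theory Num.Theory.
Import numFieldNormedType.Exports.

Set Implicit Arguments.
Unset Strict Implicit.
Unset Printing Implicit Defensive.

Local Open Scope classical_set_scope.
Local Open Scope ring_scope.

(* R^n is 'rV[R]_n.  Its library norm and balls are those of the sup norm, so
   the Euclidean ones are defined here; the library topology (compact sets,
   interiors) is the Euclidean topology, since the two norms are equivalent. *)
Section Euclidean.
Context {R : realType} {n : nat}.
Implicit Types (x y u v : 'rV[R]_n) (A B : set 'rV[R]_n).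

Definition dot x y : R := \sum_(i < n) x ord0 i * y ord0 i.

Definition enorm x : R := Num.sqrt (dot x x).

Definition unit_sphere : set 'rV[R]_n := [set x | enorm x = 1].

Definition eball x (r : R) : set 'rV[R]_n := [set y | enorm (y - x) <= r].

Definition translate A v : set 'rV[R]_n := [set x + v | x in A].

Definition minkowski_sum A B : set 'rV[R]_n := [set x + y | x in A & y in B].

Definition perp u : set 'rV[R]_n := [set x | dot x u = 0].

Definition axis u : set 'rV[R]_n := [set t *: u | t in [set: R]].

(* For a unit vector u, reflection in the hyperplane perp u. *)
Definition reflect_set u A : set 'rV[R]_n :=
  [set x - (2 * dot x u) *: u | x in A].

Definition cylinder u x (r : R) : set 'rV[R]_n :=
  minkowski_sum (eball x r `&` perp u) (axis u).

(* The 0 makes the diameter of the empty set equal to 0 instead of -oo. *)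
Definition ediam A : \bar R :=
  ereal_sup (0%:E |` [set (enorm (x - y))%:E | x in A & y in A]).

Definition convex_body A : Prop :=
  [/\ compact A, convex_set A & A° !=set0].

End Euclidean.

(* Volume of the unit ball of R^k, by the recursion
   kappa_(k+2) = 2 pi / (k+2) * kappa_k. *)
Fixpoint ball_volume (R : realType) (k : nat) : R :=
  match k with
  | 0 => 1
  | 1 => 2
  | k'.+2 => 2 * pi / k'.+2%:R * ball_volume R k'
  end.

Section Hausdorff.
Context {R : realType} {n : nat}.
Implicit Types (A B : set 'rV[R]_n) (k : nat).

Definition delta_cover (delta : R) A : set (nat -> set 'rV[R]_n) :=
  [set U | A `<=` \bigcup_i U i /\ forall i, (ediam (U i) <= delta%:E)%E].

Definition hausdorff_delta k (delta : R) A : \bar R :=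
  ereal_inf [set (\sum_(0 <= i <oo)
                   (ball_volume R k / 2 ^+ k)%:E * ediam (U i) ^+ k)%E
            | U in delta_cover delta A].

(* k-dimensional Hausdorff (outer) measure, for k > 0, with the normalization
   that makes it agree with Lebesgue measure when k = n. *)
Definition hausdorff k A : \bar R :=
  ereal_sup [set hausdorff_delta k delta A | delta in [set d : R | 0 < d]].

Definition hausdorff_ae_in k A (P : 'rV[R]_n -> Prop) : Prop :=
  hausdorff k (A `&` [set x | ~ P x]) = 0%E.

(* The class of measurable sets of finite n-dimensional measure. *)
Definition finite_measurable A : Prop :=
  (hausdorff n).-caratheodory A /\ (hausdorff n A < +oo)%E.

Definition ess_sub A B : Prop := hausdorff n (A `\` B) = 0%E.

(* `+` is the symmetric difference of sets. *)
Definition ess_eq A B : Prop := hausdorff n (A `+` B) = 0%E.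

End Hausdorff.

(* Properties of a map D on a class E of subsets of R^n; the values of D
   outside E are irrelevant. *)
Section SetMaps.
Context {R : realType} {n : nat}.
Implicit Types (E : set (set 'rV[R]_n)) (D : set 'rV[R]_n -> set 'rV[R]_n).

Definition monotonic_on E D : Prop :=
  forall K L, E K -> E L -> ess_sub K L -> ess_sub (D K) (D L).

Definition measure_preserving_on E D : Prop :=
  forall K, E K -> hausdorff n (D K) = hausdorff n K.

Definition respects_cylinders_on E (u : 'rV[R]_n) D : Prop :=
  forall K x (r : R), E K -> 0 < r ->
    ess_sub K (cylinder u x r) -> ess_sub (D K) (cylinder u x r).

Definition maps_balls_to_balls_on E D : Prop :=
  forall K x (r : R), E K -> 0 < r -> ess_eq K (eball x r) ->
    exists x' (r' : R), 0 < r' /\ ess_eq (D K) (eball x' r').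

End SetMaps.

Section Chords.
Context {R : realType} {n : nat}.
Implicit Types (K : set 'rV[R]_n) (u x : 'rV[R]_n).

(* K_t = (K - t u) `&` (K^dagger + t u). *)
Definition reflected_section K u (t : R) : set 'rV[R]_n :=
  translate K (- (t *: u)) `&` translate (reflect_set u K) (t *: u).

(* The t such that x + t u is the midpoint of the chord of the convex body K
   on the line axis u + x; a junk value if this chord is empty. *)
Definition chord_mid K u x : R :=
  let T := [set t : R | K (x + t *: u)] in (inf T + sup T) / 2.

End Chords.

(* Main.v *)
From HB Require Import structures.
Require Import Defs.
From mathcomp Require Import all_boot all_order all_algebra.
From mathcomp Require Import all_classical all_reals all_analysis.
From mathcomp Require Import measurable_realfun ring lra.
Import Order.TTheory GRing.Theory Num.Theory.
Import numFieldNormedType.Exports.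
Set Implicit Arguments.
Unset Strict Implicit.
Unset Printing Implicit Defensive.
Local Open Scope classical_set_scope.
Local Open Scope ring_scope.

(** Write [H] for the hyperplane orthogonal to [u], [shaken u phi K] for the union
    in the second statement (ii), and (i), (iii) for the other two statements.

    On the line through [x] in [H] with direction [u], let the chord of [K] have
    midpoint height [m].  A height [r] belongs to the shaken body only if for some
    [t] the two heights [t + (r - phi t)] and [t - (r - phi t)] belong to the
    chord.  Since [|phi t - phi m| <= |t - m|], this puts [r] into the chord
    shifted by [phi m - m], while the single value [t = m] already yields the
    shifted open chord.  Hence the shaken body meets the line in the shifted chord
    up to two points ([shifted_chord_section]), unless the line touches [K] without
    meeting its interior.  Such lines are negligible: the shadow of [K] lies in
    the dilates, by factors arbitrarily close to 1, of the shadow of its interior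
    ([hausdorff_tangent_feet]).  By Fubini's theorem (ii) and (iii) are equivalent
    ([ess_eq_shakenP]) and the shaken body has the measure of [K]
    ([hausdorff_shaken]).

    (ii) implies (i) because shaking is monotonic, preserves measure and lines,
    and maps a ball into a ball of the same radius, hence essentially onto it
    ([properties_of_shaken]).

    For (i) implies (ii) it suffices, the measures being equal, to show that the
    shaken body lies in [D K] essentially.  A point [p] of it gives a cylinder with
    axis direction [u], centre [x + t u] and half-height [h] that lies in [K],
    for every small radius [d].  This cylinder lies in a ball with the same centre
    and radius [sqrt (d^2 + h^2)], and the behaviour of [D] on balls and on
    cylinders confines its image to a cylinder of the same radius that is longer
    only by a term of order [d^2].  As [D] preserves measure, [D K] misses only a
    part of order [d^(n+1)] of the ball of radius [d] around [p]
    ([shaken_density], in dimension [n]).  Summing such estimates over fine covers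
    shows that [D K] misses only a null set ([hausdorff_setD_eq0]).

    The Fubini theorem in question relates the Hausdorff measures of dimensions
    [n], [n-1] and 1.  Borel sets are measurable by Caratheodory's criterion, and
    every set has a Borel hull ([hausdorff_hull]).  The [n]-dimensional measure of
    cylinders of height one defines a measure on their bases, and translation
    invariance along [u] makes the [n]-dimensional measure the product of that
    base measure and Lebesgue measure ([hausdorff_fubini]).  The base measure and
    the [(n-1)]-dimensional Hausdorff measure of [H] have the same null sets
    ([base_measure_eq0]): a set of [(n-1)]-dimensional measure zero sweeps out a
    set of [n]-dimensional measure zero ([hausdorff_sweep0]), by chopping tubes
    into pieces, and conversely ([hausdorff_sweep_eq0]), by averaging a cover over
    heights. *)

(** * Euclidean norm and topology *)

Section EuclideanNorm.
Context {R : realType} {n : nat}.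
Implicit Types (x y z u v : 'rV[R]_n) (a b c : R).

Lemma dotC x y : dot x y = dot y x.
Proof. by apply: eq_bigr => i _; rewrite mulrC. Qed.

Lemma dotDl x y z : dot (x + y) z = dot x z + dot y z.
Proof. by rewrite -big_split; apply: eq_bigr => i _; rewrite mxE mulrDl. Qed.

Lemma dotZl a x y : dot (a *: x) y = a * dot x y.
Proof. by rewrite /dot mulr_sumr; apply: eq_bigr => i _; rewrite mxE mulrA. Qed.

Lemma dotDr x y z : dot z (x + y) = dot z x + dot z y.
Proof. by rewrite dotC dotDl !(dotC z). Qed.

Lemma dotZr a x y : dot x (a *: y) = a * dot x y.
Proof. by rewrite dotC dotZl dotC. Qed.

Lemma dotNl x y : dot (- x) y = - dot x y.
Proof. by rewrite -scaleN1r dotZl mulN1r. Qed.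

Lemma dotNr x y : dot x (- y) = - dot x y.
Proof. by rewrite dotC dotNl dotC. Qed.

Lemma dotBl x y z : dot (x - y) z = dot x z - dot y z.
Proof. by rewrite dotDl dotNl. Qed.

Lemma dotBr x y z : dot z (x - y) = dot z x - dot z y.
Proof. by rewrite dotDr dotNr. Qed.

Lemma dot0l x : dot 0 x = 0.
Proof. by rewrite -(scale0r 0) dotZl mul0r. Qed.

Lemma dot_ge0 x : 0 <= dot x x.
Proof. by apply: sumr_ge0 => i _; rewrite -expr2 sqr_ge0. Qed.

Lemma sqr_coord_le_dot x i : x ord0 i ^+ 2 <= dot x x.
Proof.
rewrite /dot (bigD1 i) //= expr2 lerDl; apply: sumr_ge0 => j _.
by rewrite -expr2 sqr_ge0.
Qed.

Lemma dot_eq0 x : dot x x = 0 -> x = 0.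
Proof.
move=> x0; apply/rowP => i; rewrite mxE; apply/eqP; rewrite -sqrf_eq0.
by rewrite eq_le sqr_ge0 andbT -x0 sqr_coord_le_dot.
Qed.

Lemma enorm_ge0 x : 0 <= enorm x.
Proof. exact: sqrtr_ge0. Qed.

Lemma sqr_enorm x : enorm x ^+ 2 = dot x x.
Proof. by rewrite sqr_sqrtr ?dot_ge0. Qed.

Lemma enorm0 : enorm (0 : 'rV[R]_n) = 0.
Proof. by rewrite /enorm dot0l sqrtr0. Qed.

Lemma enorm_eq0 x : enorm x = 0 -> x = 0.
Proof. by move=> x0; apply: dot_eq0; rewrite -sqr_enorm x0 expr0n. Qed.

Lemma enorm_gt0 x : x != 0 -> 0 < enorm x.
Proof. by move=> x0; rewrite lt0r enorm_ge0 andbT; apply: contra x0 => /eqP/enorm_eq0->. Qed.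

Lemma enormZ a x : enorm (a *: x) = `|a| * enorm x.
Proof. by rewrite /enorm dotZl dotZr mulrA -expr2 sqrtrM ?sqr_ge0// sqrtr_sqr. Qed.

Lemma enormN x : enorm (- x) = enorm x.
Proof. by rewrite -scaleN1r enormZ normrN1 mul1r. Qed.

Lemma enormBC x y : enorm (x - y) = enorm (y - x).
Proof. by rewrite -enormN opprB. Qed.

(** Cauchy-Schwarz, from the nonnegativity of the square of [|y|^2 x - <x,y> y] *)
Lemma dot_le x y : `|dot x y| <= enorm x * enorm y.
Proof.
rewrite -ler_sqr ?nnegrE ?mulr_ge0 ?enorm_ge0 ?normr_ge0//.
rewrite exprMn !sqr_enorm real_normK ?num_real//.
have [->|y0] := eqVneq y 0; first by rewrite dot0l mulr0 dotC dot0l expr0n.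
have yp : 0 < dot y y by rewrite -sqr_enorm exprn_gt0// enorm_gt0.
have := dot_ge0 (dot y y *: x - dot x y *: y).
rewrite dotBl !dotBr !dotZl !dotZr (dotC y x).
have -> : dot y y * (dot y y * dot x x) - dot y y * (dot x y * dot x y) -
   (dot x y * (dot y y * dot x y) - dot x y * (dot x y * dot y y)) =
   dot y y * (dot x x * dot y y - dot x y ^+ 2) by ring.
by rewrite pmulr_rge0// subr_ge0.
Qed.

Lemma ler_enormD x y : enorm (x + y) <= enorm x + enorm y.
Proof.
rewrite -ler_sqr ?nnegrE ?addr_ge0 ?enorm_ge0//.
rewrite sqrrD !sqr_enorm dotDl !dotDr (dotC y x).
have := le_trans (ler_norm _) (dot_le x y); lra.
Qed.

Lemma ler_enormB x y z : enorm (x - z) <= enorm (x - y) + enorm (y - z).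
Proof. by apply: le_trans (ler_enormD _ _); rewrite addrA subrK. Qed.

Lemma norm_le_enorm x : `|x| <= enorm x.
Proof.
rewrite [leLHS]/Num.norm /= mx_normrE; apply/bigmax_leP; split; first exact: enorm_ge0.
move=> [i j] _ /=; rewrite (ord1 i) -ler_sqr ?nnegrE ?enorm_ge0//.
by rewrite real_normK ?num_real// sqr_enorm sqr_coord_le_dot.
Qed.

Lemma coord_le_norm x i : `|x ord0 i| <= `|x|.
Proof.
rewrite [leRHS]/Num.norm /= mx_normrE.
exact: (le_bigmax _ (fun ij : 'I_1 * 'I_n => `|x ij.1 ij.2|) (ord0, i)).
Qed.

Lemma enorm_le_norm x : enorm x <= n%:R * `|x|.
Proof.
rewrite -ler_sqr ?nnegrE ?enorm_ge0 ?mulr_ge0//.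
rewrite sqr_enorm exprMn.
apply: (@le_trans _ _ (\sum_(i < n) `|x| ^+ 2)).
  apply: ler_sum => i _; rewrite -expr2 -[leLHS]real_normK ?num_real//.
  by rewrite ler_sqr ?nnegrE// coord_le_norm.
rewrite sumr_const card_ord -[leLHS]mulr_natl; apply: ler_wpM2r; first exact: sqr_ge0.
by rewrite expr2 -natrM ler_nat; case: (n) => // m; rewrite leq_pmulr.
Qed.

End EuclideanNorm.

Section EuclideanTopology.
Context {R : realType} {n : nat}.
Implicit Types (x y z u v : 'rV[R]_n) (a b c : R) (A : set 'rV[R]_n).

(** The Euclidean and the sup norm are equivalent; from here on the topology is
    described with Euclidean balls. *)
Lemma nbhs_enormP x A :
  nbhs x A <-> exists2 r, 0 < r & eball x r `<=` A.
Proof.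
split.
- move=> /nbhs_ballP[r /= r0 rA]; exists (r / 2); first by rewrite divr_gt0.
  move=> y /= yx; apply: rA; rewrite mx_norm_ball /ball_ /=.
  rewrite -normrN opprB; apply: le_lt_trans (norm_le_enorm _) _.
  by apply: le_lt_trans yx _; rewrite ltr_pdivrMr// ltr_pMr// ltr1n.
- move=> [r r0 rA]; apply/nbhs_ballP; exists (r / n.+1%:R) => /=.
    by rewrite divr_gt0.
  move=> y; rewrite mx_norm_ball /ball_ /= => yx; apply: rA => /=.
  rewrite /eball /= enormBC; apply: le_trans (enorm_le_norm _) _.
  have /ltW : `|x - y| * n.+1%:R < r by rewrite -ltr_pdivlMr.
  apply: le_trans; rewrite mulrC ler_wpM2l// ler_nat//.
Qed.

Lemma interior_enormP x A : A° x <-> exists2 r, 0 < r & eball x r `<=` A.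
Proof. exact: nbhs_enormP. Qed.

Lemma open_enormP A :
  open A <-> forall x, A x -> exists2 r, 0 < r & eball x r `<=` A.
Proof.
rewrite openE; split => [oA x /oA/nbhs_enormP//|h x /h/nbhs_enormP//].
Qed.

Lemma closure_enormP A x :
  closure A x <-> forall r, 0 < r -> exists2 y, A y & enorm (y - x) <= r.
Proof.
split=> [h r r0|h B /nbhs_enormP[r r0 rB]].
  have /h[y [Ay yB]] : nbhs x (eball x r) by apply/nbhs_enormP; exists r.
  by exists y.
by have [y Ay yx] := h _ r0; exists y; split=> //; exact: rB.
Qed.

Lemma closed_enormP A :
  closed A <-> forall x, (forall r, 0 < r -> exists2 y, A y & enorm (y - x) <= r) -> A x.
Proof.
by split=> cA x; [move=> h; apply: cA; apply/closure_enormP|move/closure_enormP/cA].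
Qed.

Lemma enorm_lip x y : `|enorm x - enorm y| <= enorm (x - y).
Proof.
have h (a b : 'rV[R]_n) : enorm a - enorm b <= enorm (a - b).
  by rewrite lerBlDr; apply: le_trans (ler_enormD _ _); rewrite subrK.
rewrite ler_norml h andbT lerNl opprB enormBC; exact: h.
Qed.

(** A map that is Lipschitz for the Euclidean norm and the norm of its target
    is continuous, as the two norms of the source are equivalent. *)
Lemma elipschitz_continuous (V : normedModType R) (f : 'rV[R]_n -> V) (C : R) :
  (forall x y, `|f x - f y| <= C * enorm (x - y)) -> continuous f.
Proof.
move=> h x A /nbhs_ballP[e /= e0 eA].
have C1 : 0 < `|C| + 1 by rewrite ltr_wpDl.
apply/nbhs_enormP; exists (e / 2 / (`|C| + 1)); first by rewrite !divr_gt0.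
move=> y /= yx; apply: eA; rewrite -ball_normE /ball_ /=.
suff : `|f x - f y| <= e / 2 by move=> /le_lt_trans; apply; rewrite gtr_pMr// invf_lt1// ltr1n.
apply: le_trans (h _ _) _; rewrite enormBC.
apply: (@le_trans _ _ ((`|C| + 1) * enorm (y - x))).
  by rewrite ler_wpM2r ?enorm_ge0// (le_trans (ler_norm _))// lerDl.
by rewrite mulrC -ler_pdivlMr.
Qed.

Lemma dot_continuous u : continuous (fun x : 'rV[R]_n => dot x u).
Proof.
apply: (@elipschitz_continuous _ _ (enorm u)) => x y.
by rewrite -dotBl mulrC dot_le.
Qed.

Lemma elipschitz_continuousV m (f : 'rV[R]_n -> 'rV[R]_m) (C : R) :
  (forall x y, enorm (f x - f y) <= C * enorm (x - y)) -> continuous f.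
Proof.
move=> h; apply: (@elipschitz_continuous _ _ C) => x y.
exact: le_trans (norm_le_enorm _) (h _ _).
Qed.

Lemma closed_eball x r : closed (eball x r).
Proof.
apply/closed_enormP => y h; rewrite /eball /=; apply/ler_addgt0Pr => e e0.
have [z + zy] := h _ e0.
rewrite /eball /= => zx; have := ler_enormB y z x; rewrite (enormBC y z); lra.
Qed.

Lemma bounded_eballP A : bounded_set A <-> exists r, A `<=` eball 0 r.
Proof.
split.
- move=> [M [_ hM]]; exists (n%:R * (M + 1)) => x Ax; rewrite /eball /= subr0.
  apply: le_trans (enorm_le_norm _) _; rewrite ler_wpM2l//.
  by apply: hM => //; rewrite ltrDl.
- move=> [r h]; exists r; split; first exact: num_real.
  move=> s rs x /h; rewrite /eball /= subr0 => xr.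
  exact: le_trans (norm_le_enorm _) (le_trans xr (ltW rs)).
Qed.

Lemma compact_enormP A : compact A <-> closed A /\ exists r, A `<=` eball 0 r.
Proof.
split=> [cA|[cA /bounded_eballP bA]]; last exact: bounded_closed_compact.
split; first exact: (compact_closed (@norm_hausdorff _ _) cA).
by apply/bounded_eballP; exact: compact_bounded.
Qed.

End EuclideanTopology.

(** * Hausdorff measure as an outer measure *)

Definition diam_le {R : realType} {n} (U : set 'rV[R]_n) (d : R) : Prop :=
  forall x y, U x -> U y -> enorm (x - y) <= d.

Definition hausdorff_cst (R : realType) (k : nat) : R := ball_volume R k / 2 ^+ k.

Lemma ball_volume_gt0 (R : realType) k : 0 < ball_volume R k.
Proof.
suff : 0 < ball_volume R k /\ 0 < ball_volume R k.+1 by case.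
elim: k => [|k [IH1 IH2]]; first by split; rewrite /= ?ltr01 ?ltr0n.
by split=> //=; rewrite !mulr_gt0// ?invr_gt0 ?ltr0n// pi_gt0.
Qed.

Lemma hausdorff_cst_gt0 (R : realType) k : 0 < hausdorff_cst R k.
Proof. by rewrite divr_gt0 ?ball_volume_gt0// exprn_gt0. Qed.

Section HausdorffCovers.
Context {R : realType} {n : nat}.
Implicit Types (U A B : set 'rV[R]_n) (k : nat) (d e : R).

Lemma ediam_ge0 U : (0 <= ediam U)%E.
Proof. by apply: ereal_sup_ubound; left. Qed.

Lemma ediam_leP U d : 0 <= d -> (ediam U <= d%:E)%E <-> diam_le U d.
Proof.
move=> d0; split=> [h x y Ux Uy|h].
  rewrite -lee_fin; apply: le_trans h; apply: ereal_sup_ubound.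
  by right; exists x => //; exists y.
by apply: ge_ereal_sup => _ [->|[x Ux [y Uy <-]]]; rewrite lee_fin//; exact: h.
Qed.

Lemma ediam_fin U d : (ediam U <= d%:E)%E -> exists2 r : R, ediam U = r%:E & 0 <= r <= d.
Proof.
have := ediam_ge0 U; case: (ediam U) => [r||]//; rewrite !lee_fin => r0 rd.
by exists r => //; rewrite r0.
Qed.

Lemma ediam_set0 : ediam (set0 : set 'rV[R]_n) = 0%E.
Proof. by apply/eqP; rewrite eq_le ediam_ge0 andbT; apply/(@ediam_leP _ 0). Qed.

Definition gauge k d U : \bar R :=
  if (ediam U <= d%:E)%E then ((hausdorff_cst R k)%:E * ediam U ^+ k)%E else +oo%E.

Lemma gauge_ge0 k d U : (0 <= gauge k d U)%E.
Proof.
rewrite /gauge; case: ifP => // _; apply: mule_ge0.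
  by rewrite lee_fin ltW// hausdorff_cst_gt0.
exact/expe_ge0/ediam_ge0.
Qed.

Lemma gauge0 k d : 0 <= d -> gauge k.+1 d set0 = 0%E.
Proof. by move=> d0; rewrite /gauge ediam_set0 lee_fin d0 expeS mul0e mule0. Qed.

(** The infimum over covers by sets of small diameter is an instance of the
    outer extension of a set function: every set is allowed in a cover, and
    sets of large diameter get infinite weight.  Countable subadditivity then
    comes from the general theory. *)
Local Notation all_sets := (g_sigma_algebraType [set: set 'rV[R]_n]).

Lemma hausdorff_deltaE k d A :
  hausdorff_delta k d A = mu_ext (T := all_sets) (gauge k d) A.
Proof.
apply/eqP; rewrite eq_le; apply/andP; split.
- apply: le_ereal_inf_tmp => _ [F [mF AF] <-].
  have [hF|] := pselect (forall i, (ediam (F i) <= d%:E)%E).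
    apply: ereal_inf_lbound; exists F => //.
    by apply: eq_eseriesr => i _; rewrite /gauge hF.
  move=> /existsNP[i /negP /negPf hi].
  rewrite (@eseries_pinfty _ _ _ i)// ?leey//; last by rewrite /gauge hi.
  by move=> j _; rewrite -ltNye; apply: lt_le_trans (gauge_ge0 _ _ _).
- apply: le_ereal_inf_tmp => _ [F [AF dF] <-].
  apply: ereal_inf_lbound; exists F.
    by split=> // i; exact: sub_sigma_algebra.
  by apply: eq_eseriesr => i _; rewrite /gauge dF.
Qed.

Lemma hausdorff_delta_ge0 k d A : (0 <= hausdorff_delta k d A)%E.
Proof. rewrite hausdorff_deltaE; apply: mu_ext_ge0; exact: gauge_ge0. Qed.

Lemma hausdorff_delta0 k d : 0 <= d -> hausdorff_delta k.+1 d (set0 : set 'rV[R]_n) = 0%E.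
Proof.
by move=> d0; rewrite hausdorff_deltaE; apply: mu_ext0; [exact: gauge0|exact: gauge_ge0].
Qed.

Lemma le_hausdorff_delta k d A B :
  A `<=` B -> (hausdorff_delta k d A <= hausdorff_delta k d B)%E.
Proof. by rewrite !hausdorff_deltaE; exact: (@le_mu_ext _ all_sets R (gauge k d)). Qed.

Lemma hausdorff_delta_sigma_subadditive k d :
  sigma_subadditive (hausdorff_delta k d : set 'rV[R]_n -> \bar R).
Proof.
move=> F; rewrite hausdorff_deltaE; under eq_eseriesr do rewrite hausdorff_deltaE.
by apply: (@mu_ext_sigma_subadditive _ all_sets) => X; exact: gauge_ge0.
Qed.

Lemma hausdorff_delta_anti k d e A : d <= e ->
  (hausdorff_delta k e A <= hausdorff_delta k d A)%E.
Proof.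
move=> de; apply: le_ereal_inf_tmp => _ [F [AF dF] <-].
apply: ereal_inf_lbound; exists F => //; split=> // i.
by apply: le_trans (dF i) _; rewrite lee_fin.
Qed.

Lemma hausdorff_delta_le k d A : 0 < d -> (hausdorff_delta k d A <= hausdorff k A)%E.
Proof. by move=> d0; apply: ereal_sup_ubound; exists d. Qed.

Lemma hausdorff_leP k A (M : \bar R) :
  (forall d, 0 < d -> (hausdorff_delta k d A <= M)%E) -> (hausdorff k A <= M)%E.
Proof. by move=> h; apply: ge_ereal_sup => _ [d d0 <-]; exact: h. Qed.

Lemma hausdorff0 k : hausdorff k.+1 (set0 : set 'rV[R]_n) = 0%E.
Proof.
apply/eqP; rewrite eq_le; apply/andP; split.
  by apply: hausdorff_leP => d d0; rewrite hausdorff_delta0// ltW.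
exact: le_trans (hausdorff_delta_ge0 _ _ _) (hausdorff_delta_le _ _ ltr01).
Qed.

Lemma hausdorff_ge0 k A : (0 <= hausdorff k A)%E.
Proof. exact: le_trans (hausdorff_delta_ge0 _ _ _) (hausdorff_delta_le _ _ ltr01). Qed.

Lemma le_hausdorff k : {homo (hausdorff k : set 'rV[R]_n -> \bar R) : A B / A `<=` B >-> (A <= B)%E}.
Proof.
move=> A B AB; apply: hausdorff_leP => d d0.
exact: le_trans (le_hausdorff_delta _ _ AB) (hausdorff_delta_le _ _ d0).
Qed.

Lemma hausdorff_sigma_subadditive k :
  sigma_subadditive (hausdorff k : set 'rV[R]_n -> \bar R).
Proof.
move=> F; apply: hausdorff_leP => d d0.
apply: le_trans (hausdorff_delta_sigma_subadditive _ _ _) _.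
apply: lee_nneseries => [i _ _|i _]; first exact: hausdorff_delta_ge0.
exact: hausdorff_delta_le.
Qed.

(* In dimension zero the empty sets of a cover would have weight one; the
   dimension is therefore written as a successor. *)
HB.instance Definition _ k := isOuterMeasure.Build R 'rV[R]_n (hausdorff k.+1)
  (hausdorff0 k) (hausdorff_ge0 k.+1) (@le_hausdorff k.+1)
  (@hausdorff_sigma_subadditive k.+1).

(** Covers are handled through positive real bounds [d i] on the diameters;
    positivity lets one divide by them. *)
Lemma hausdorff_delta_cover k e A (M : R) : 0 < e ->
  (hausdorff_delta k.+1 e A < (hausdorff_cst R k.+1 * M)%:E)%E ->
  exists (U : nat -> set 'rV[R]_n) (d : nat -> R),
    [/\ A `<=` \bigcup_i U i, forall i, 0 < d i <= e, forall i, diam_le (U i) (d i)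
      & (\sum_(i <oo) (d i ^+ k.+1)%:E < M%:E)%E].
Proof.
move=> e0 /ereal_inf_lt[_ [U [AU dU] <-]].
have [r rE] : {r : nat -> R & forall i, ediam (U i) = (r i)%:E /\ 0 <= r i <= e}.
  apply: (@choice _ _ (fun i r => ediam (U i) = r%:E /\ 0 <= r <= e)) => i.
  by have [r rE re] := ediam_fin (dU i); exists r.
have r0 i : 0 <= r i by have [_ /andP[]] := rE i.
under eq_eseriesr do rewrite (rE _).1 -EFin_expe.
rewrite nneseriesZl; last by move=> i _; rewrite lee_fin exprn_ge0.
rewrite -[(ball_volume R k.+1 / 2 ^+ k.+1)%:E]/((hausdorff_cst R k.+1)%:E) (EFinM (hausdorff_cst R k.+1)).
rewrite lte_pmul2l//; last by rewrite lte_fin hausdorff_cst_gt0.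
set S := (X in (X < _)%E) => SM.
have S0 : (0 <= S)%E by apply: nneseries_ge0 => i _ _; rewrite lee_fin exprn_ge0.
have [s sE] : exists s, S = s%:E.
  by exists (fine S); rewrite fineK// ge0_fin_numE// (lt_trans SM)// ltry.
rewrite sE lte_fin in SM.
pose q := Num.min (Num.min 1 e) ((M - s) / 2).
have q0 : 0 < q by rewrite !lt_min ltr01 e0 divr_gt0 ?subr_gt0.
pose t i := q / (2 ^ i.+1)%:R.
have t0 i : 0 < t i by rewrite divr_gt0// ltr0n expn_gt0.
have tq i : t i <= q.
  rewrite ler_pdivrMr ?ltr0n ?expn_gt0// ler_peMr ?(ltW q0)// ler1n expn_gt0//.
exists U, (fun i => Num.max (r i) (t i)); split => //.
- move=> i; rewrite lt_max t0 orbT ge_max; have [_ /andP[_ ->]] := rE i.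
  by rewrite (le_trans (tq i))// !ge_min lexx orbT.
- move=> i; apply/ediam_leP; first by rewrite le_max r0.
  by rewrite (rE i).1 lee_fin le_max lexx.
- apply: (@le_lt_trans _ _ (\sum_(i <oo) ((r i ^+ k.+1)%:E + (t i)%:E))%E).
    apply: lee_nneseries => [i _ _|i _]; first by rewrite lee_fin exprn_ge0// le_max r0.
    rewrite lee_fin; have [rt|tr] := leP (r i) (t i).
      rewrite -[leLHS]add0r lerD ?exprn_ge0//.
      rewrite exprS ler_piMr// ?(ltW (t0 i))// exprn_ile1// ?(ltW (t0 i))//.
      by apply: le_trans (tq i) _; rewrite !ge_min lexx.
    by rewrite lerDl ltW.
  apply: le_lt_trans (epsilon_trick _ _ _) _ => //; last 1 first.
  + rewrite -/S sE -EFinD lte_fin.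
    have : q <= (M - s) / 2 by rewrite ge_min lexx orbT.
    lra.
  + by move=> i; rewrite lee_fin exprn_ge0.
  + exact: ltW.
Qed.

Lemma hausdorff_delta_le_cover k e A (U : nat -> set 'rV[R]_n) (d : nat -> R) :
  A `<=` \bigcup_i U i -> (forall i, 0 <= d i <= e) -> (forall i, diam_le (U i) (d i)) ->
  (hausdorff_delta k e A <= (hausdorff_cst R k)%:E * \sum_(i <oo) (d i ^+ k)%:E)%E.
Proof.
move=> AU de dU.
have hd i : (ediam (U i) <= (d i)%:E)%E.
  by apply/ediam_leP => //; have /andP[] := de i.
apply: (@le_trans _ _ (\sum_(i <oo) ((hausdorff_cst R k)%:E * ediam (U i) ^+ k))%E).
  apply: ereal_inf_lbound; exists U => //; split => // i.
  by apply: le_trans (hd i) _; rewrite lee_fin; have /andP[] := de i.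
rewrite -nneseriesZl; last first.
  by move=> i _; rewrite lee_fin exprn_ge0//; have /andP[] := de i.
apply: lee_nneseries => [i _ _|i _].
  by rewrite mule_ge0 ?expe_ge0 ?ediam_ge0// lee_fin ltW// hausdorff_cst_gt0.
rewrite lee_pmul2l ?lte_fin ?hausdorff_cst_gt0//.
have [r -> /andP[r0 rd]] := ediam_fin (hd i).
by rewrite -EFin_expe lee_fin lerXn2r// nnegrE// (le_trans r0).
Qed.

Lemma hausdorff_delta_le_diam k e U d : 0 <= d <= e -> diam_le U d ->
  (hausdorff_delta k.+1 e U <= (hausdorff_cst R k.+1 * d ^+ k.+1)%:E)%E.
Proof.
move=> /andP[d0 de] dU.
apply: le_trans (@hausdorff_delta_le_cover k.+1 e U (fun i => if i is 0 then U else set0)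
  (fun i => if i is 0 then d else 0) _ _ _) _.
- by move=> x Ux; exists 0%N.
- by case=> [|i]; rewrite ?d0 ?lexx ?(le_trans d0).
- by case=> [|i].
rewrite nneseries_recl//; last by case=> [|i] _; rewrite lee_fin exprn_ge0.
by rewrite eseries0 ?adde0 ?EFinM// => -[|i] //= _ _; rewrite exprS mul0r.
Qed.

End HausdorffCovers.

(** * Lipschitz images and Caratheodory's criterion *)

(** Lets a bound by an infimum be proved from the covers that nearly attain it *)
Lemma lee_of_real (R : realType) (x y : \bar R) : (0 <= y)%E ->
  (forall M : R, (y < M%:E)%E -> (x <= M%:E)%E) -> (x <= y)%E.
Proof.
case: y => [y| |]// _ h; last by rewrite leey.
by apply/lee_addgt0Pr => e e0; rewrite -EFinD; apply: h; rewrite lte_fin ltrDl.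
Qed.

Section LipschitzImages.
Context {R : realType} {n m : nat}.
Implicit Types (k : nat) (d e s : R).

(** The images of the sets of a cover form a cover, with diameters scaled by [s]. *)
Lemma hausdorff_delta_lip k d s (f : 'rV[R]_n -> 'rV[R]_m) (A : set 'rV[R]_n) :
  0 < d -> 0 < s ->
  (forall x y, A x -> A y -> enorm (f x - f y) <= s * enorm (x - y)) ->
  (hausdorff_delta k.+1 (s * d) (f @` A) <=
     (s ^+ k.+1)%:E * hausdorff_delta k.+1 d A)%E.
Proof.
move=> d0 s0 fs.
have sk : 0 < s ^+ k.+1 by rewrite exprn_gt0.
have c0 := hausdorff_cst_gt0 R k.+1.
apply: lee_of_real => [|M].
  by rewrite mule_ge0 ?hausdorff_delta_ge0// lee_fin ltW.
rewrite -lte_pdivlMl// -EFinM => h.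
have /(hausdorff_delta_cover d0)[U [r [AU rd dU sM]]] :
    (hausdorff_delta k.+1 d A < (hausdorff_cst R k.+1 * ((hausdorff_cst R k.+1)^-1 * (s ^- k.+1 * M)))%:E)%E.
  by rewrite mulVKf// gt_eqF.
apply: le_trans (@hausdorff_delta_le_cover _ _ k.+1 (s * d) _
  (fun i => f @` (U i `&` A)) (fun i => s * r i) _ _ _) _.
- by move=> _ [x Ax <-]; have [i _ Ui] := AU _ Ax; exists i => //; exists x.
- move=> i; have /andP[r0 rd'] := rd i.
  by rewrite mulr_ge0 ?(ltW s0) ?(ltW r0)//= ler_wpM2l// ltW.
- move=> i _ _ [x [Ux Ax] <-] [y [Uy Ay] <-].
  by apply: le_trans (fs _ _ Ax Ay) _; rewrite ler_wpM2l ?(ltW s0)//; exact: dU.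
under eq_eseriesr do rewrite exprMn EFinM.
rewrite nneseriesZl; last first.
  by move=> i _; rewrite lee_fin exprn_ge0// ltW//; have /andP[] := rd i.
rewrite muleA -EFinM.
apply: le_trans (lee_wpmul2l _ (ltW sM)) _; first by rewrite lee_fin mulr_ge0// ltW.
rewrite -EFinM lee_fin.
by rewrite [hausdorff_cst _ _ * _]mulrC -mulrA !mulVKf ?gt_eqF.
Qed.

Lemma hausdorff_lip k s (f : 'rV[R]_n -> 'rV[R]_m) (A : set 'rV[R]_n) : 0 < s ->
  (forall x y, A x -> A y -> enorm (f x - f y) <= s * enorm (x - y)) ->
  (hausdorff k.+1 (f @` A) <= (s ^+ k.+1)%:E * hausdorff k.+1 A)%E.
Proof.
move=> s0 fs; apply: hausdorff_leP => d d0.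
have ds : 0 < d / s by rewrite divr_gt0.
have -> : d = s * (d / s) by rewrite mulrC divfK// gt_eqF.
apply: le_trans (hausdorff_delta_lip _ ds s0 fs) _.
apply: lee_wpmul2l; last exact: hausdorff_delta_le.
by rewrite lee_fin exprn_ge0// ltW.
Qed.

End LipschitzImages.

Section Separated.
Context {R : realType} {n : nat}.
Implicit Types (k : nat) (d e s : R) (A B X O : set 'rV[R]_n).

(** A set of diameter less than [e] meets at most one of [A] and [B], so that a
    cover of the union splits into covers of the two parts. *)
Lemma hausdorff_delta_separated k d e A B : 0 < d < e ->
  (forall x y, A x -> B y -> e <= enorm (x - y)) ->
  (hausdorff_delta k.+1 d A + hausdorff_delta k.+1 d B <=
     hausdorff_delta k.+1 d (A `|` B))%E.
Proof.
move=> /andP[d0 de] sep.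
have c0 := hausdorff_cst_gt0 R k.+1.
apply: lee_of_real; first exact: hausdorff_delta_ge0.
move=> M; rewrite -{1}(divfK (lt0r_neq0 c0) M) mulrC.
move=> /(hausdorff_delta_cover d0)[U [r [AU rd dU sM]]].
have r0 i : 0 <= r i by have /andP[/ltW] := rd i.
pose ra X i := if `[< U i `&` X !=set0 >] then r i else 0.
have ra0 X i : 0 <= ra X i by rewrite /ra; case: asboolP.
have bnd X : X `<=` A `|` B ->
    (hausdorff_delta k.+1 d X <= (hausdorff_cst R k.+1)%:E * \sum_(i <oo) (ra X i ^+ k.+1)%:E)%E.
  move=> XAB; apply: (@hausdorff_delta_le_cover _ _ k.+1 d _ (fun i => U i `&` X)).
  - by move=> x Xx; have [i _ Ui] := AU _ (XAB _ Xx); exists i.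
  - move=> i; rewrite ra0 /ra; case: asboolP => _; last exact: ltW.
    by have /andP[] := rd i.
  - move=> i x y [Ux Xx] [Uy Xy]; rewrite /ra; case: asboolP => [_|[]]; first exact: dU.
    by exists x.
apply: le_trans (leeD (bnd _ (@subsetUl _ _ _)) (bnd _ (@subsetUr _ _ _))) _.
rewrite -muleDr//; last first.
  by rewrite ge0_adde_def// inE; apply: nneseries_ge0 => i _ _; rewrite lee_fin exprn_ge0.
rewrite -nneseriesD; try by move=> i _ _; rewrite lee_fin exprn_ge0.
have -> : M%:E = ((hausdorff_cst R k.+1)%:E * (M / hausdorff_cst R k.+1)%:E)%E.
  by rewrite -EFinM mulrC divfK// gt_eqF.
rewrite lee_pmul2l ?lte_fin//.
apply: le_trans (ltW sM); apply: lee_nneseries => [i _ _|i _].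
  by rewrite -EFinD lee_fin addr_ge0// exprn_ge0.
rewrite -EFinD lee_fin /ra.
case: asboolP => [[x [Ux Ax]]|_]; case: asboolP => [[y [Uy By]]|_].
- have := le_trans (sep _ _ Ax By) (dU i _ _ Ux Uy).
  have /andP[_ rid] := rd i.
  by move=> /le_trans/(_ rid); rewrite leNgt de.
- by rewrite [0 ^+ _]exprS mul0r addr0.
- by rewrite [0 ^+ _]exprS mul0r add0r.
- by rewrite [0 ^+ _]exprS mul0r add0r exprn_ge0.
Qed.

Lemma hausdorff_separated k e A B : 0 < e ->
  (forall x y, A x -> B y -> e <= enorm (x - y)) ->
  (hausdorff k.+1 A + hausdorff k.+1 B <= hausdorff k.+1 (A `|` B))%E.
Proof.
move=> e0 sep.
have [->|ABoo] := eqVneq (hausdorff k.+1 (A `|` B)) +oo%E; first by rewrite leey.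
have fin X : X `<=` A `|` B -> hausdorff k.+1 X \is a fin_num.
  move=> XAB; rewrite ge0_fin_numE ?hausdorff_ge0//.
  by apply: le_lt_trans (le_hausdorff _ XAB) _; rewrite ltey.
have [fA fB] := (fin _ (@subsetUl _ A B), fin _ (@subsetUr _ A B)).
have dfin X d : 0 < d -> hausdorff k.+1 X \is a fin_num -> hausdorff_delta k.+1 d X \is a fin_num.
  move=> d0; rewrite !ge0_fin_numE ?hausdorff_ge0 ?hausdorff_delta_ge0//.
  exact/le_lt_trans/hausdorff_delta_le.
rewrite -leeBrDr//; apply: hausdorff_leP => d1 d10.
rewrite leeBrDr// addeC -leeBrDr ?dfin//; apply: hausdorff_leP => d2 d20.
rewrite leeBrDr ?dfin// addeC.
pose d := Num.min (Num.min d1 d2) (e / 2).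
have d0 : 0 < d by rewrite !lt_min d10 d20 divr_gt0.
have de : d < e by rewrite gt_min [e / 2 < e]gtr_pMr// invf_lt1 ?ltr1n// orbT.
have dd1 : d <= d1 by rewrite !ge_min lexx.
have dd2 : d <= d2 by rewrite !ge_min lexx orbT.
apply: le_trans (hausdorff_delta_le _ _ d0).
apply: le_trans (@hausdorff_delta_separated k d e A B _ sep); last by rewrite d0.
by apply: leeD; exact: hausdorff_delta_anti.
Qed.

(** Caratheodory's criterion for open sets: the part of [X] inside [O] is
    exhausted by the sets [A j] of its points at distance more than [1/(j+1)]
    from the complement of [O].  Two shells [A (j+1) \ A j] whose indices differ
    by at least two are at a positive distance, so that the measures of the
    shells have a finite sum, and its tail bounds what [A j] misses. *)
Lemma open_caratheodory k O : open O -> (hausdorff k.+1).-caratheodory O.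
Proof.
move=> /open_enormP oO; apply: le_caratheodory_measurable => X /=.
set mu := hausdorff k.+1.
have [->|Xoo] := eqVneq (mu X) +oo%E; first by rewrite leey.
pose A j := X `&` [set y | O y /\ forall z, ~ O z -> j.+1%:R^-1 < enorm (z - y)].
have AS : {homo A : i j / (i <= j)%N >-> i `<=` j}.
  move=> i j ij y [Xy [Oy h]]; split=> //; split=> // z /h; apply: le_lt_trans.
  by rewrite lef_pV2 ?posrE ?ltr0n// ler_nat.
have AX j : A j `<=` X by move=> y [].
have far j : (mu (A j) + mu (X `&` ~` O) <= mu X)%E.
  apply: le_trans (le_hausdorff _ (_ : A j `|` (X `&` ~` O) `<=` X)).
    apply: (@hausdorff_separated _ j.+1%:R^-1); first by rewrite invr_gt0 ltr0n.
    by move=> x y [_ [_ h]] [_ Oy]; rewrite enormBC ltW// h.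
  by move=> y [/AX|[]].
pose D j := A j.+2 `\` A j.+1.
have AD j : (mu (A j) + mu (D j) <= mu (A j.+2))%E.
  apply: le_trans (le_hausdorff _ (_ : A j `|` D j `<=` A j.+2)); last first.
    by move=> y [/AS|[]//]; apply; rewrite ltnW.
  apply: (@hausdorff_separated _ (j.+1%:R^-1 - j.+2%:R^-1)).
    by rewrite subr_gt0 ltf_pV2 ?posrE ?ltr0n// ltr_nat.
  move=> x y [_ [Ox hx]] [[Xy [Oy _]] Ay].
  have [z Oz zy] : exists2 z, ~ O z & enorm (z - y) <= j.+2%:R^-1.
    apply: contrapT => h; apply: Ay; split=> //; split=> // z Oz.
    by rewrite ltNge; apply/negP => zy; apply: h; exists z.
  rewrite lerBlDr; apply: le_trans (ltW (hx _ Oz)) _.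
  by apply: le_trans (ler_enormB z y x) _; rewrite addrC (enormBC y x) lerD.
have sumD N : (\sum_(j < N) mu (D j) <= mu (A N) + mu (A N.+1))%E.
  elim: N => [|N IH]; first by rewrite big_ord0 adde_ge0// hausdorff_ge0.
  rewrite big_ord_recr/=; apply: le_trans (leeD2r _ IH) _.
  rewrite [(mu (A N) + _)%E]addeC -addeA; exact/leeD2l/AD.
have Dfin : (\sum_(0 <= j <oo) mu (D j) < +oo)%E.
  apply: (@le_lt_trans _ _ (mu X + mu X)%E); last first.
    by rewrite lte_add_pinfty// ltey.
  apply: lime_le; first by apply: is_cvg_nneseries => *; exact: hausdorff_ge0.
  apply: nearW => N; rewrite big_mkord; apply: le_trans (sumD N) _.
  by apply: leeD; apply: le_hausdorff.
have tail e : 0 < e -> exists N, (\sum_(N <= j <oo) mu (D j) <= e%:E)%E.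
  move=> e0; have /fine_cvgP[[N1 _ fin] /cvgr0Pnorm_le/(_ _ e0)[N2 _ h]] :=
    nneseries_tail_cvg Dfin (fun j _ => hausdorff_ge0 _ _).
  exists (maxn N1 N2); have /fineK <- := fin _ (leq_maxl N1 N2).
  by rewrite lee_fin (le_trans (ler_norm _))//; exact: h (leq_maxr _ _).
apply/lee_addgt0Pr => e /tail[N hN].
have XO : (mu (X `&` O) <= mu (A N.+1) + e%:E)%E.
  have cov : X `&` O `<=` A N.+1 `|` \bigcup_(j in ~` `I_N) D j.
    move=> y [Xy Oy].
    have [r r0 ry] := oO _ Oy.
    have [i ri] := ltr_add_invr r0; rewrite add0r in ri.
    have Ai : A i y.
      split=> //; split=> // z Oz; rewrite ltNge; apply/negP => zy; apply: Oz.
      by apply: ry; rewrite /eball /=; apply: le_trans zy (ltW ri).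
    have [AN|AN] := pselect (A N.+1 y); [by left|right].
    pose P j := `[< A j y >].
    have exP : exists j, P j by exists i; exact/asboolP.
    case: (ex_minnP exP) => j /asboolP Aj jmin.
    have Nj : (N.+1 < j)%N.
      by rewrite ltnNge; apply/negP => jN; exact/AN/(AS _ _ jN).
    case: j Aj jmin Nj => [//|[//|j]] Aj jmin Nj.
    exists j => /=; first by apply/negP; rewrite -leqNgt.
    split=> // /asboolP/jmin; by rewrite ltnn.
  apply: le_trans (le_hausdorff _ cov) _.
  apply: le_trans (outer_measureU2 _ _ _) _; apply: leeD => //.
  apply: le_trans (outer_measure_sigma_subadditive_tail _ _ _) hN.
apply: le_trans (leeD2r _ XO) _.
rewrite -addeA [(e%:E + _)%E]addeC addeA leeD2r//; exact: far.
Qed.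

End Separated.

(** * Borel hulls and swept sets *)

Definition borel_rV (R : realType) (n : nat) :=
  g_sigma_algebraType (@open 'rV[R]_n).

Section BorelHull.
Context {R : realType} {n : nat}.
Implicit Types (k : nat) (d e s : R) (A B X O : set 'rV[R]_n).

Lemma open_borel O : open O -> measurable (O : set (borel_rV R n)).
Proof. exact: sub_sigma_algebra. Qed.

Lemma closed_borel O : closed O -> measurable (O : set (borel_rV R n)).
Proof.
by move=> cO; rewrite -(setCK O); apply: measurableC; apply: open_borel; exact: closed_openC.
Qed.

Lemma borel_caratheodory k A :
  measurable (A : set (borel_rV R n)) -> (hausdorff k.+1).-caratheodory A.
Proof.
apply: smallest_sub; last exact: open_caratheodory.
exact: (@sigma_algebra_measurable _ (caratheodory_type (@hausdorff R n k.+1))).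
Qed.

Lemma diam_le_closure (U : set 'rV[R]_n) d : diam_le U d -> diam_le (closure U) d.
Proof.
move=> dU x y /closure_enormP hx /closure_enormP hy; apply/ler_addgt0Pr => e e0.
have e20 : 0 < e / 2 by rewrite divr_gt0.
have [x' Ux' xx'] := hx _ e20; have [y' Uy' yy'] := hy _ e20.
have := ler_enormB x x' y; have := ler_enormB x' y' y; have := dU _ _ Ux' Uy'.
rewrite (enormBC x x'); lra.
Qed.

(** Closing the sets of a cover does not change their diameters, hence every
    set lies in a Borel set of the same Hausdorff measure. *)
Lemma hausdorff_hull k A :
  exists G, [/\ measurable (G : set (borel_rV R n)), A `<=` G
    & hausdorff k.+1 G = hausdorff k.+1 A].
Proof.
suff [G [mG AG GA]] : exists G, [/\ measurable (G : set (borel_rV R n)), A `<=` G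
    & (hausdorff k.+1 G <= hausdorff k.+1 A)%E].
  by exists G; split=> //; apply/eqP; rewrite eq_le GA le_hausdorff.
have [->|Aoo] := eqVneq (hausdorff k.+1 A) +oo%E.
  by exists setT; split=> //; rewrite leey.
have Afin : hausdorff k.+1 A \is a fin_num.
  by rewrite ge0_fin_numE ?hausdorff_ge0// ltey.
pose a := fine (hausdorff k.+1 A); have aE : hausdorff k.+1 A = a%:E by rewrite fineK.
have c0 := hausdorff_cst_gt0 R k.+1.
have e0 j : 0 < j.+1%:R^-1 :> R by rewrite invr_gt0 ltr0n.
have cov j : exists Ud : (nat -> set 'rV[R]_n) * (nat -> R),
    [/\ A `<=` \bigcup_i Ud.1 i, forall i, 0 < Ud.2 i <= j.+1%:R^-1,
      forall i, diam_le (Ud.1 i) (Ud.2 i)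
      & ((hausdorff_cst R k.+1)%:E * \sum_(i <oo) (Ud.2 i ^+ k.+1)%:E <= (a + j.+1%:R^-1)%:E)%E].
  have : (hausdorff_delta k.+1 j.+1%:R^-1 A <
      (hausdorff_cst R k.+1 * ((a + j.+1%:R^-1) / hausdorff_cst R k.+1))%:E)%E.
    rewrite mulrC divfK ?gt_eqF//.
    by apply: le_lt_trans (hausdorff_delta_le _ _ (e0 j)) _; rewrite aE lte_fin ltrDl.
  move=> /(hausdorff_delta_cover (e0 j))[U [d [AU dj dU /ltW sU]]].
  exists (U, d); split=> //=.
  apply: le_trans (lee_wpmul2l _ sU) _; first by rewrite lee_fin ltW.
  by rewrite -EFinM mulrC divfK// gt_eqF.
have [Ud hUd] := choice cov.
exists (\bigcap_j \bigcup_i closure ((Ud j).1 i)); split.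
- apply: bigcapT_measurable => j; apply: bigcupT_measurable => i.
  by apply: closed_borel; exact: closed_closure.
- move=> x Ax j _; have [/(_ _ Ax)[i _ Ui] _ _ _] := hUd j.
  by exists i => //; exact: subset_closure.
- apply: hausdorff_leP => d d0; apply/lee_addgt0Pr => e e00.
  have de0 : 0 < Num.min d e by rewrite lt_min d0 e00.
  have [j] := ltr_add_invr de0.
  rewrite add0r lt_min => /andP[/ltW jd /ltW je].
  apply: le_trans (hausdorff_delta_anti _ _ jd) _.
  have [_ dj dU sU] := hUd j.
  apply: le_trans (@hausdorff_delta_le_cover _ _ k.+1 _ _
    (fun i => closure ((Ud j).1 i)) (Ud j).2 _ _ _) _.
  + by move=> x /(_ j I).
  + by move=> i; have /andP[/ltW -> ->] := dj i.
  + by move=> i; apply: diam_le_closure.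
  apply: le_trans sU _; by rewrite aE -EFinD lee_fin lerD2l.
Qed.

End BorelHull.

Section FiniteSeries.
Context {R : realType}.

Lemma nneseries_finite (a : R) (N : nat) : 0 <= a ->
  (\sum_(i <oo) (if (i < N)%N then a else 0)%:E = (N%:R * a)%:E)%E.
Proof.
move=> a0; rewrite (@nneseries_split _ _ 0%N N); last first.
  by move=> i _; rewrite lee_fin; case: ifP.
rewrite add0n [X in (_ + X)%E]eseries0; last first.
  by move=> i Ni _; rewrite ltnNge Ni.
rewrite adde0 big_mkord sumEFin; congr EFin.
by rewrite (eq_bigr (fun=> a)) ?sumr_const ?card_ord ?mulr_natl// => i _; rewrite ltn_ord.
Qed.

End FiniteSeries.

Section Sweep.
Context {R : realType} {n : nat}.
Implicit Types (k : nat) (d e s t : R) (A B X O W U : set 'rV[R]_n) (u v : 'rV[R]_n).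

Definition sweep W v : set 'rV[R]_n :=
  [set w + t *: v | w in W & t in `[0, 1]%classic].

(** A set of diameter [d <= 1] sweeps out a tube that about [1/d] sets of
    diameter [2d] cover. *)
Lemma hausdorff_delta_sweep_diam k e d U v : enorm v = 1 ->
  0 < d <= 1 -> 2 * d <= e -> diam_le U d ->
  (hausdorff_delta k.+1 e (sweep U v) <= (hausdorff_cst R k.+1 * 2 ^+ k.+2 * d ^+ k)%:E)%E.
Proof.
move=> v1 /andP[d0 d1] de dU.
pose N := (Num.trunc d^-1).+1.
have dV0 : 0 <= d^-1 by rewrite invr_ge0 ltW.
have /andP[N1 N2] := truncn_itv dV0.
pose P j := if (j < N)%N then
  [set x | exists w t, [/\ U w, j%:R * d <= t <= j.+1%:R * d & x = w + t *: v]] else set0.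
apply: le_trans (@hausdorff_delta_le_cover _ _ k.+1 e _ P
   (fun j => if (j < N)%N then 2 * d else 0) _ _ _) _.
- move=> _ [w Uw [t /= t01 <-]]; move: t01; rewrite in_itv/= => /andP[t0 t1].
  have td0 : 0 <= t / d by rewrite divr_ge0// ltW.
  have /andP[T1 T2] := truncn_itv td0.
  have TN : (Num.trunc (t / d) < N)%N.
    rewrite -(ltr_nat R); apply: le_lt_trans T1 _; apply: le_lt_trans N2.
    by rewrite -[leRHS]mul1r ler_wpM2r.
  exists (Num.trunc (t / d)) => //; rewrite /P TN; exists w, t; split => //.
  by rewrite -ler_pdivlMr// T1 -ler_pdivrMr// ltW.
- by move=> j; case: ifP => _; rewrite ?lexx ?mulr_ge0 ?(ltW d0)//= (le_trans _ de)// mulr_ge0// ltW.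
- move=> j x y; rewrite /P; case: ifP => // _.
  move=> [w [t [Uw /andP[t1 t2] ->]]] [w' [t' [Uw' /andP[t'1 t'2] ->]]].
  have -> : w + t *: v - (w' + t' *: v) = (w - w') + (t - t') *: v.
    by rewrite opprD addrACA scalerBl.
  apply: le_trans (ler_enormD _ _) _; rewrite enormZ v1 mulr1.
  have -> : 2 * d = d + d by rewrite mulr_natl.
  apply: lerD; first exact: dU.
  move: t2 t'2; rewrite -natr1 mulrDl mul1r ler_norml => t2 t'2.
  by apply/andP; split; lra.
rewrite (eq_eseriesr (g := fun j => (if (j < N)%N then (2 * d) ^+ k.+1 else 0)%:E)); last first.
  by move=> j _; case: ifP => // _; rewrite exprS mul0r.
rewrite nneseries_finite ?exprn_ge0 ?mulr_ge0 ?(ltW d0)//.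
rewrite -EFinM lee_fin -mulrA ler_wpM2l// ?(ltW (hausdorff_cst_gt0 _ _))//.
have ND : N%:R * d <= 2.
  rewrite -ler_pdivlMr// /N -natr1; apply: le_trans (lerD N1 (lexx 1)) _.
  have -> : 2 / d = d^-1 + d^-1 by rewrite mulr_natl.
  by rewrite lerD2l -invr1 lef_pV2 ?posrE.
rewrite exprMn (exprS d k) [2 ^+ k.+2]exprS.
have -> : N%:R * (2 ^+ k.+1 * (d * d ^+ k)) = (N%:R * d) * (2 ^+ k.+1 * d ^+ k) by ring.
rewrite -[leRHS]mulrA.
by rewrite ler_wpM2r// !mulr_ge0 ?exprn_ge0// ltW.
Qed.

(** The tubes swept by the sets of a cover of [W] cover what [W] sweeps out. *)
Lemma hausdorff_sweep_le k W v M : enorm v = 1 ->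
  (hausdorff k.+1 W < (hausdorff_cst R k.+1 * M)%:E)%E ->
  (hausdorff k.+2 (sweep W v) <= (hausdorff_cst R k.+2 * 2 ^+ k.+3 * M)%:E)%E.
Proof.
move=> v1 HW; apply: hausdorff_leP => e e0.
pose e' := Num.min 1 (e / 2).
have e'0 : 0 < e' by rewrite lt_min ltr01 divr_gt0.
have /(hausdorff_delta_cover e'0)[U [d [WU de dU sM]]] :=
  le_lt_trans (hausdorff_delta_le _ _ e'0) HW.
have cov : sweep W v `<=` \bigcup_i sweep (U i) v.
  move=> _ [w Ww [t t01 <-]]; have [i _ Ui] := WU _ Ww.
  by exists i => //; exists w => //; exists t.
apply: le_trans (le_hausdorff_delta _ _ cov) _.
apply: le_trans (hausdorff_delta_sigma_subadditive _ _ _) _.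
apply: (@le_trans _ _ (\sum_(i <oo) ((hausdorff_cst R k.+2 * 2 ^+ k.+3)%:E * (d i ^+ k.+1)%:E))%E).
  apply: lee_nneseries => [i _ _|i _]; first exact: hausdorff_delta_ge0.
  rewrite -EFinM; have /andP[d0 dei] := de i.
  apply: hausdorff_delta_sweep_diam => //.
    by rewrite d0 (le_trans dei)// ge_min lexx.
  by rewrite mulrC -ler_pdivlMr// (le_trans dei)// ge_min lexx orbT.
rewrite nneseriesZl; last by move=> i _; rewrite lee_fin exprn_ge0// ltW//; have /andP[] := de i.
rewrite [leRHS]EFinM; apply: lee_wpmul2l; last exact: ltW.
by rewrite lee_fin mulr_ge0 ?exprn_ge0// ltW// hausdorff_cst_gt0.
Qed.

Lemma hausdorff_sweep_fin k W v : enorm v = 1 ->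
  (hausdorff k.+1 W < +oo)%E -> (hausdorff k.+2 (sweep W v) < +oo)%E.
Proof.
move=> v1 Woo; have Wfin : hausdorff k.+1 W \is a fin_num.
  by rewrite ge0_fin_numE// hausdorff_ge0.
apply: le_lt_trans (@hausdorff_sweep_le k W v ((fine (hausdorff k.+1 W) + 1) / hausdorff_cst R k.+1) v1 _) _.
  rewrite mulrC divfK ?gt_eqF ?hausdorff_cst_gt0//.
  by rewrite EFinD fineK// lteDl// ?lte_fin.
by rewrite ltry.
Qed.

Lemma hausdorff_sweep0 k W v : enorm v = 1 ->
  hausdorff k.+1 W = 0%E -> hausdorff k.+2 (sweep W v) = 0%E.
Proof.
move=> v1 W0; apply/eqP; rewrite eq_le hausdorff_ge0 andbT.
apply: lee_of_real => // M; rewrite lte_fin => M0.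
have C0 : 0 < hausdorff_cst R k.+2 * 2 ^+ k.+3 by rewrite mulr_gt0 ?exprn_gt0 ?hausdorff_cst_gt0.
have := @hausdorff_sweep_le k W v (M / (hausdorff_cst R k.+2 * 2 ^+ k.+3)) v1.
rewrite [X in (_ <= X%:E)%E]mulrC divfK ?gt_eqF// W0; apply.
by rewrite lte_fin mulr_gt0 ?hausdorff_cst_gt0// divr_gt0.
Qed.

Lemma hausdorff1_segment_fin x v : enorm v = 1 ->
  (hausdorff 1 (sweep [set x] v) < +oo)%E.
Proof.
move=> v1; apply: (@le_lt_trans _ _ (hausdorff_cst R 1 * 2 ^+ 2)%:E); last by rewrite ltry.
apply: hausdorff_leP => e e0.
pose d := Num.min 1 (e / 2).
have d0 : 0 < d by rewrite lt_min ltr01 divr_gt0.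
have := @hausdorff_delta_sweep_diam 0 e d [set x] v v1.
rewrite expr0 mulr1; apply.
- by rewrite d0 ge_min lexx.
- by rewrite mulrC -ler_pdivlMr// ge_min lexx orbT.
- by move=> _ _ -> ->; rewrite subrr enorm0 ltW.
Qed.

End Sweep.

(** * Slicing, density and the measure of balls *)

Section SweepConverse.
Context {R : realType} {n : nat}.
Implicit Types (k : nat) (d e s t : R) (A B X O W U : set 'rV[R]_n) (u v : 'rV[R]_n).
Local Notation leb := (@lebesgue_measure R).

Lemma lebesgue_ball_itv (a d : R) : 0 < d ->
  leb `[a - d, a + d]%classic = (2 * d)%:E.
Proof.
move=> d0; rewrite lebesgue_measure_itv /= lte_fin.
have -> : a - d < a + d by lra.
by rewrite -EFinB; congr EFin; lra.
Qed.

Lemma dot_line_le u x y d : enorm u = 1 -> enorm (x - y) <= d ->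
  dot y u - d <= dot x u <= dot y u + d.
Proof.
move=> u1 xy; have := le_trans (dot_le (x - y) u) _; rewrite u1 mulr1 => /(_ _ xy).
by rewrite dotBl ler_norml => /andP[h1 h2]; apply/andP; split; lra.
Qed.

(** A converse for sets orthogonal to the sweep: each slice of a cover of the
    swept set at height [t] covers a translate of [W], and a set of diameter
    [d] meets only heights in an interval of length [2d].  Averaging over [t]
    therefore gains a factor [d] for each set of the cover. *)
Lemma hausdorff_sweep_eq0 k W u c : enorm u = 1 -> (forall w, W w -> dot w u = c) ->
  hausdorff k.+2 (sweep W u) = 0%E -> hausdorff k.+1 W = 0%E.
Proof.
move=> u1 Wc W0; apply/eqP; rewrite eq_le hausdorff_ge0 andbT.
apply: hausdorff_leP => e e0.
apply: lee_of_real => // M; rewrite lte_fin => M0.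
set h := hausdorff_delta k.+1 e W.
have c0 := hausdorff_cst_gt0 R k.+1.
pose q := M / (hausdorff_cst R k.+1 * 2).
have q0 : 0 < q by rewrite divr_gt0// mulr_gt0.
have /(hausdorff_delta_cover e0)[U [d [WU de dU sq]]] :
    (hausdorff_delta k.+2 e (sweep W u) < (hausdorff_cst R k.+2 * q)%:E)%E.
  apply: le_lt_trans (hausdorff_delta_le _ _ e0) _.
  by rewrite W0 lte_fin mulr_gt0// hausdorff_cst_gt0.
have d0 i : 0 < d i by have /andP[] := de i.
pose p i := xget 0 (U i).
pose I i : set (measurableTypeR R) := `[dot (p i) u - c - d i, dot (p i) u - c + d i]%classic.
pose f i (t : measurableTypeR R) := ((d i ^+ k.+1)%:E * (\1_(I i) t)%:E)%E.
have mI i : measurable (I i) by exact: measurable_itv.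
have f0 i t : (0 <= f i t)%E by rewrite mule_ge0// lee_fin ?exprn_ge0// ltW.
pose J : set (measurableTypeR R) := `[0, 1]%classic.
have mf i : measurable_fun J (f i).
  apply: emeasurable_funM => //; apply/measurable_EFinP; exact: measurable_indic.
have hf t : J t -> (h <= (hausdorff_cst R k.+1)%:E * \sum_(i <oo) f i t)%E.
  move=> t01.
  have -> : (\sum_(i <oo) f i t = \sum_(i <oo) ((d i * \1_(I i) t) ^+ k.+1)%:E)%E.
    apply: eq_eseriesr => i _; rewrite /f -EFinM exprMn; congr (_ * _)%:E.
    by rewrite indicE; case: (_ \in _); rewrite ?expr1n// exprS mul0r.
  apply: (@hausdorff_delta_le_cover _ _ k.+1 e _
    (fun i => if t \in I i then [set w | U i (w + t *: u)] else set0)).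
  - move=> w Ww; have [|i _ Ui] := WU (w + t *: u); first by exists w => //; exists t.
    exists i => //; rewrite ifT// inE /I /= in_itv/=.
    have Up : U i (p i) by exact: xgetPex (ex_intro _ _ Ui).
    have := dot_line_le u1 (dU _ _ _ Ui Up).
    rewrite dotDl dotZl -(sqr_enorm u) u1 expr1n mulr1 (Wc _ Ww) => /andP[h1 h2].
    by apply/andP; split; lra.
  - move=> i; rewrite indicE; have /andP[/ltW di1 di2] := de i.
    by case: (_ \in _); rewrite ?mulr1 ?mulr0 ?di1 ?lexx// ltW.
  - move=> i x y; rewrite indicE; case: (_ \in _) => // Ux Uy.
    by have := dU _ _ _ Ux Uy; rewrite opprD addrACA subrr addr0 mulr1.
have mJ : measurable J by exact: measurable_itv.
have hE : (\int[leb]_(t in J) cst h t)%E = h.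
  by rewrite integral_cst//= lebesgue_measure_itv /= lte_fin ltr01 -EFinB subr0 mule1.
have mS : measurable_fun J (fun t => \sum_(i <oo) f i t)%E.
  by apply: ge0_emeasurable_sum.
rewrite -hE.
apply: (@le_trans _ _ (\int[leb]_(t in J) ((hausdorff_cst R k.+1)%:E * \sum_(i <oo) f i t))%E).
  apply: ge0_le_integral => //.
  - by move=> t _; exact: hausdorff_delta_ge0.
  - exact: measurable_funeM.
rewrite ge0_integralZl_EFin//; last 2 first.
  - by move=> t _; apply: nneseries_ge0.
  - exact: ltW.
rewrite integral_nneseries//.
apply: (@le_trans _ _ ((hausdorff_cst R k.+1)%:E * \sum_(i <oo) (2%:E * (d i ^+ k.+2)%:E))%E).
  apply: lee_wpmul2l; first by rewrite lee_fin ltW.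
  apply: lee_nneseries => [i _ _|i _]; first exact: integral_ge0.
  rewrite /f ge0_integralZl_EFin//; last 2 first.
  - by apply/measurable_EFinP; exact: measurable_indic.
  - by rewrite exprn_ge0// ltW.
  rewrite integral_indic//.
  apply: (@le_trans _ _ ((d i ^+ k.+1)%:E * leb (I i))%E).
    apply: lee_wpmul2l; first by rewrite lee_fin exprn_ge0// ltW.
    by apply: le_measure; rewrite ?inE//; exact: measurableI.
  by rewrite /I lebesgue_ball_itv// -!EFinM lee_fin [d i ^+ k.+2]exprS; lra.
rewrite nneseriesZl; last by move=> i _; rewrite lee_fin exprn_ge0// ltW.
rewrite muleA -EFinM.
apply: le_trans (lee_wpmul2l _ (ltW sq)) _; first by rewrite lee_fin mulr_ge0// ltW.
by rewrite -EFinM lee_fin /q mulrC divfK// gt_eqF// mulr_gt0.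
Qed.

(** The sets of a cover of the image of [S] meet the line within intervals of
    twice their diameter, and these intervals cover [S]. *)
Lemma lebesgue_line_eq0 (x u : 'rV[R]_n) (S : set (measurableTypeR R)) :
  enorm u = 1 -> measurable S ->
  hausdorff 1 [set x + t *: u | t in S] = 0%E -> leb S = 0%E.
Proof.
move=> u1 mS S0; apply/eqP; rewrite eq_le measure_ge0 andbT.
apply: lee_of_real => // M; rewrite lte_fin => M0.
move: S0; set L := (X in hausdorff 1 X) => S0.
have : (hausdorff_delta 1 1 L < (hausdorff_cst R 1 * (M / 2))%:E)%E.
  apply: le_lt_trans (hausdorff_delta_le _ _ ltr01) _.
  by rewrite S0 lte_fin mulr_gt0 ?hausdorff_cst_gt0// divr_gt0.
move=> /(hausdorff_delta_cover ltr01)[U [d [SU de dU sM]]].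
have d0 i : 0 < d i by have /andP[] := de i.
pose p i := xget 0 (U i).
pose I i : set (measurableTypeR R) :=
  `[dot (p i) u - dot x u - d i, dot (p i) u - dot x u + d i]%classic.
have SI : S `<=` \bigcup_i I i.
  move=> t St; have [|i _ Ui] := SU (x + t *: u); first by rewrite /L; exists t.
  exists i => //; rewrite /I /= in_itv/=.
  have Up : U i (p i) by exact: xgetPex (ex_intro _ _ Ui).
  have := dot_line_le u1 (dU _ _ _ Ui Up).
  rewrite dotDl dotZl -(sqr_enorm u) u1 expr1n mulr1 => /andP[h1 h2].
  by apply/andP; split; lra.
apply: le_trans (measure_sigma_subadditive _ _ mS SI) _.
  by move=> i; exact: measurable_itv.
apply: (@le_trans _ _ (\sum_(i <oo) (2%:E * (d i ^+ 1)%:E))%E).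
  apply: lee_nneseries => // i _ /=; rewrite /I lebesgue_ball_itv// expr1.
rewrite nneseriesZl; last by move=> i _; rewrite lee_fin exprn_ge0// ltW.
apply: le_trans (lee_wpmul2l _ (ltW sM)) _; first by rewrite lee_fin.
by rewrite -EFinM lee_fin; lra.
Qed.

End SweepConverse.

Section Density.
Context {R : realType} {n : nat}.
Implicit Types (k : nat) (d e s t : R) (A B X O W U V E : set 'rV[R]_n) (u v : 'rV[R]_n).

(** Split [V] into countably many parts on which the constant and the range of
    radii are uniform.  For a cover of such a part by sets of diameter at most [e],
    the bounds sum up to a total of order [e]. *)
Lemma hausdorff_setD_eq0 k V E : (hausdorff k.+1 V < +oo)%E ->
  (forall y, V y -> exists C r : R, 0 < r /\ forall d, 0 < d <= r ->
     (hausdorff k.+1 (eball y d `\` E) <= (C * d ^+ k.+2)%:E)%E) ->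
  hausdorff k.+1 (V `\` E) = 0%E.
Proof.
move=> Voo hV.
pose W j := V `&` [set y | forall d, 0 < d <= j.+1%:R^-1 ->
  (hausdorff k.+1 (eball y d `\` E) <= (j.+1%:R * d ^+ k.+2)%:E)%E].
have VW : V `\` E `<=` \bigcup_j (W j `\` E).
  move=> y [Vy Ey]; have [C [r [r0 h]]] := hV _ Vy.
  have [i ir] := ltr_add_invr r0; rewrite add0r in ir.
  pose N := maxn i (Num.trunc `|C|).
  exists N => //; split=> //; split=> // d /andP[d0 dN].
  have dr : d <= r.
    apply: le_trans dN _; apply: le_trans (ltW ir).
    by rewrite lef_pV2 ?posrE ?ltr0n// ler_nat ltnS leq_maxl.
  apply: le_trans (h _ _) _; first by rewrite d0.
  rewrite lee_fin ler_wpM2r ?exprn_ge0 ?(ltW d0)//.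
  apply: le_trans (ler_norm _) _.
  have /andP[_ /ltW hC] := truncn_itv (normr_ge0 C).
  by apply: le_trans hC _; rewrite ler_nat ltnS leq_maxr.
apply/eqP; rewrite eq_le hausdorff_ge0 andbT.
apply: le_trans (le_hausdorff _ VW) _.
apply: le_trans (hausdorff_sigma_subadditive _ _) _.
rewrite eseries0// => j _ _.
apply/eqP; rewrite eq_le hausdorff_ge0 andbT.
have Vfin : hausdorff k.+1 V \is a fin_num by rewrite ge0_fin_numE// hausdorff_ge0.
pose M := (fine (hausdorff k.+1 V) + 1) / hausdorff_cst R k.+1.
have M0 : 0 < M.
  by rewrite divr_gt0 ?hausdorff_cst_gt0// ltr_wpDl// fine_ge0// hausdorff_ge0.
apply: lee_of_real => // q; rewrite lte_fin => q0.
pose e := Num.min j.+1%:R^-1 (q / (j.+1%:R * M)).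
have e0 : 0 < e by rewrite lt_min invr_gt0 ltr0n divr_gt0// mulr_gt0// ltr0n.
have : (hausdorff_delta k.+1 e (W j) < (hausdorff_cst R k.+1 * M)%:E)%E.
  apply: le_lt_trans (hausdorff_delta_le _ _ e0) _.
  apply: le_lt_trans (le_hausdorff _ (_ : W j `<=` V)) _; first by move=> y [].
  rewrite /M mulrC divfK ?gt_eqF ?hausdorff_cst_gt0//.
  by rewrite EFinD fineK// lteDl// ?lte_fin.
move=> /(hausdorff_delta_cover e0)[U [d [WU de dU sM]]].
have d0 i : 0 < d i by have /andP[] := de i.
have cov : W j `\` E `<=` \bigcup_i ((U i `&` W j) `\` E).
  by move=> y [Wy Ey]; have [i _ Ui] := WU _ Wy; exists i.
apply: le_trans (le_hausdorff _ cov) _.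
apply: le_trans (hausdorff_sigma_subadditive _ _) _.
apply: (@le_trans _ _ (\sum_(i <oo) ((j.+1%:R * e)%:E * (d i ^+ k.+1)%:E))%E).
  apply: lee_nneseries => [i _ _|i _]; first exact: hausdorff_ge0.
  rewrite -EFinM; have [[y [Uy Wy]]|h] := pselect (U i `&` W j !=set0).
    have /andP[_ die] := de i.
    apply: (@le_trans _ _ (hausdorff k.+1 (eball y (d i) `\` E))).
      by apply: le_hausdorff => z [[Uz Wz] Ez]; split=> //; exact: dU.
    apply: le_trans (Wy.2 _ _) _; first by rewrite d0 (le_trans die)// ge_min lexx.
    rewrite lee_fin exprS -!mulrA ler_wpM2l// ler_wpM2r// exprn_ge0// ltW//.
  have -> : U i `&` W j = set0 by apply: contrapT => /eqP/set0P.
  by rewrite set0D hausdorff0 lee_fin !mulr_ge0 ?exprn_ge0// ltW.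
rewrite nneseriesZl; last by move=> i _; rewrite lee_fin exprn_ge0// ltW.
apply: le_trans (lee_wpmul2l _ (ltW sM)) _; first by rewrite lee_fin mulr_ge0// ltW.
have jM : 0 < j.+1%:R * M by rewrite mulr_gt0// ltr0n.
rewrite -EFinM lee_fin mulrAC mulrC -ler_pdivlMr//.
by rewrite ge_min lexx orbT.
Qed.

End Density.

Section Cubes.
Context {R : realType} {n : nat}.
Implicit Types (k : nat) (r s : R) (x : 'rV[R]_n.+1).

(** The unit cube of the first [k] coordinates *)
Definition face k : set 'rV[R]_n.+1 :=
  [set y | forall i : 'I_n.+1, if (i < k)%N then 0 <= y ord0 i <= 1 else y ord0 i == 0].

Lemma enorm_delta (i : 'I_n.+1) : enorm (delta_mx ord0 i : 'rV[R]_n.+1) = 1.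
Proof.
rewrite /enorm /dot (bigD1 i)//= big1 ?addr0 => [|j ji].
  by rewrite mxE !eqxx mulr1 sqrtr1.
by rewrite mxE (negPf ji) andbF mulr0.
Qed.

Lemma face_sweep k (kn : (k < n.+1)%N) :
  face k.+1 = sweep (face k) (delta_mx ord0 (Ordinal kn)).
Proof.
apply/seteqP; split=> [y yk|_ [w wk [t /= t01 <-]] i].
- pose t := y ord0 (Ordinal kn); exists (y - t *: delta_mx ord0 (Ordinal kn)).
    move=> i; rewrite !mxE eqxx /=.
    have [->|ik] := eqVneq i (Ordinal kn); first by rewrite ltnn mulr1 subrr.
    have {}ik : (nat_of_ord i == k) = false by exact: (negPf ik).
    by rewrite mulr0 subr0; have := yk i; rewrite ltnS leq_eqVlt ik.
  exists t; last by rewrite subrK.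
  by have := yk (Ordinal kn); rewrite /= ltnSn in_itv.
- have := wk i; rewrite !mxE eqxx /=.
  have [->|ik] := eqVneq i (Ordinal kn).
    by rewrite ltnn ltnSn mulr1 => /eqP->; rewrite add0r; move: t01; rewrite in_itv.
  have {}ik : (nat_of_ord i == k) = false by exact: (negPf ik).
  by rewrite mulr0 addr0 ltnS [(i <= k)%N]leq_eqVlt ik.
Qed.

Lemma face0 : face 0 = [set 0].
Proof.
apply/seteqP; split=> [y h|_ -> i]; last by rewrite /= mxE.
by apply/rowP => i; rewrite mxE; exact/eqP/(h i).
Qed.

(** The cube of dimension [k+1] is swept by the cube of dimension [k]: sweeping
    keeps a finite measure finite and, conversely, a nonzero measure nonzero. *)
Lemma hausdorff_face k : (k < n.+1)%N ->
  (hausdorff k.+1 (face k.+1) < +oo)%E /\ hausdorff k.+1 (face k.+1) <> 0%E.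
Proof.
elim: k => [k0|k IH kn].
  rewrite (face_sweep k0) face0; split.
    exact: hausdorff1_segment_fin (enorm_delta _).
  move=> h0.
  have := @lebesgue_line_eq0 R n.+1 0 (delta_mx ord0 (Ordinal k0)) `[0, 1]%classic
    (enorm_delta _) (measurable_itv _).
  have -> : [set 0 + t *: delta_mx ord0 (Ordinal k0) | t in `[0, 1]%classic] =
      sweep [set (0 : 'rV[R]_n.+1)] (delta_mx ord0 (Ordinal k0)).
    apply/seteqP; split=> [_ [t t01 <-]|_ [_ -> [t t01 <-]]]; last by exists t.
    by exists 0 => //; exists t.
  move=> /(_ h0); rewrite lebesgue_measure_itv /= lte_fin ltr01 -EFinB subr0.
  by move=> [] /eqP; rewrite oner_eq0.
have [IH1 IH2] := IH (ltnW kn).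
rewrite (face_sweep kn); split.
  exact: hausdorff_sweep_fin (enorm_delta _) IH1.
move=> h0; apply: IH2; apply: (hausdorff_sweep_eq0 (c := 0) (enorm_delta _) _ h0).
move=> w wk; rewrite /dot (bigD1 (Ordinal kn))//= big1 ?addr0 => [|j ji].
  by have := wk (Ordinal kn); rewrite /= ltnn => /eqP->; rewrite mul0r.
by rewrite mxE (negPf ji) andbF mulr0.
Qed.

Lemma hausdorff_eball_fin x r : (hausdorff n.+1 (eball x r) < +oo)%E.
Proof.
wlog r0 : r / 0 < r.
  move=> H; have [/H//|r0] := ltP 0 r.
  apply: le_lt_trans (le_hausdorff _ _) (H _ ltr01) => y; rewrite /eball /= => yx.
  by rewrite (le_trans yx)// (le_trans r0).
have [h _] := hausdorff_face (ltnSn n).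
pose f (y : 'rV[R]_n.+1) := x + ((2 * r) *: y - const_mx r).
have r2 : 0 < 2 * r by rewrite mulr_gt0.
apply: (@le_lt_trans _ _ (hausdorff n.+1 (f @` face n.+1))).
  apply: le_hausdorff => y yx.
  exists ((2 * r)^-1 *: (y - x + const_mx r)); last first.
    by rewrite /f scalerA divff ?gt_eqF// scale1r addrK addrC subrK.
  move=> i; rewrite ltn_ord mxE.
  have : `|(y - x) ord0 i| <= r.
    by apply: le_trans (coord_le_norm _ _) _; apply: le_trans (norm_le_enorm _) yx.
  rewrite ler_norml => /andP[h1 h2]; rewrite mulrC.
  rewrite divr_ge0 ?(ltW r2)//=; last by rewrite [leRHS]mxE [X in _ + X]mxE; lra.
  by rewrite ler_pdivrMr// mxE [X in _ + X]mxE; lra.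
apply: le_lt_trans (hausdorff_lip (s := 2 * r) _ _ _) _ => //.
  move=> y z _ _; rewrite /f opprD addrACA subrr add0r.
  by rewrite opprB addrA subrK -scalerBr enormZ gtr0_norm.
by rewrite lte_mul_pinfty// lee_fin exprn_ge0// ltW.
Qed.

Lemma hausdorff_eball_neq0 x r : 0 < r -> hausdorff n.+1 (eball x r) <> 0%E.
Proof.
move=> r0 h0; have [_] := hausdorff_face (ltnSn n); apply.
pose s := n.+1%:R / r; have s0 : 0 < s by rewrite divr_gt0.
apply/eqP; rewrite eq_le hausdorff_ge0 andbT.
pose f (y : 'rV[R]_n.+1) := s *: (y - x).
apply: (@le_trans _ _ (hausdorff n.+1 (f @` eball x r))).
  apply: le_hausdorff => y yQ; exists (x + s^-1 *: y); last first.
    by rewrite /f addrC addKr scalerA divff ?gt_eqF// scale1r.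
  rewrite /eball /= addrC addKr enormZ ger0_norm ?invr_ge0 ?(ltW s0)//.
  rewrite /s invf_div mulrAC ler_pdivrMr// ler_wpM2l ?(ltW r0)//.
  apply: le_trans (enorm_le_norm _) _; rewrite -[leRHS]mulr1 ler_wpM2l//.
  rewrite [leLHS]/Num.norm /= mx_normrE; apply/bigmax_leP; split => // -[i j] _ /=.
  by rewrite (ord1 i); have := yQ j; rewrite ltn_ord => /andP[y0 y1]; rewrite ger0_norm.
apply: le_trans (hausdorff_lip (s := s) _ _ _) _ => //.
  by move=> y z _ _; rewrite /f -scalerBr opprB addrA subrK enormZ gtr0_norm.
by rewrite h0 mule0.
Qed.

End Cubes.

(** * Translation-invariant measures on the line *)

Section HausdorffBorelMeasure.
Context {R : realType} {n : nat}.

Definition hausdorffB (k : nat) : set (borel_rV R n) -> \bar R := hausdorff k.+1.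

Let hausdorffB0 k : hausdorffB k set0 = 0%E. Proof. exact: hausdorff0. Qed.

Let hausdorffB_ge0 k A : (0 <= hausdorffB k A)%E. Proof. exact: hausdorff_ge0. Qed.

Let hausdorffB_sigma_additive k : semi_sigma_additive (hausdorffB k).
Proof.
move=> F mF tF mUF.
apply: (@caratheodory_measure_sigma_additive R 'rV[R]_n (@hausdorff R n k.+1)) => //.
- by move=> i; exact: borel_caratheodory.
- exact: borel_caratheodory.
Qed.

HB.instance Definition _ k := isMeasure.Build _ _ _ (hausdorffB k)
  (hausdorffB0 k) (hausdorffB_ge0 k) (@hausdorffB_sigma_additive k).

Lemma continuous_borel m (f : 'rV[R]_n -> 'rV[R]_m) : continuous f ->
  measurable_fun setT (f : borel_rV R n -> borel_rV R m).
Proof.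
move=> cf; apply: (@measurability _ _ (borel_rV R n) (borel_rV R m) setT f
  (@open 'rV[R]_m)) => // _ [G oG <-]; rewrite setTI.
by apply: open_borel; apply: open_comp => // x _; exact: cf.
Qed.

Lemma continuous_borelR (f : 'rV[R]_n -> R) : continuous f ->
  measurable_fun setT (f : borel_rV R n -> measurableTypeR R).
Proof.
move=> cf; apply: (measurability (@RGenOInfty.G R)).
  exact: RGenOInfty.measurableE.
move=> _ [_ [a ->] <-]; rewrite setTI.
by apply: open_borel; apply: open_comp => [x _|]; [exact: cf|exact: rray_open].
Qed.

End HausdorffBorelMeasure.

Section TranslationInvariance.
Context {R : realType}.
Implicit Types (a b c s : R).
Local Notation leb := (@lebesgue_measure R).
Local Notation oc a b := (`]a%R, b%R]%classic : set (measurableTypeR R)).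

(** Additivity and monotonicity determine a translation-invariant measure on
    half-open intervals: exactly on those of rational length, hence on all. *)
Lemma translation_invariant_measure (mu : {measure set (measurableTypeR R) -> \bar R}) :
  (forall a b s, mu (oc (a + s) (b + s)) = mu (oc a b)) -> (mu (oc 0 1) < +oo)%E ->
  forall A, measurable A -> mu A = (mu (oc 0 1) * leb A)%E.
Proof.
move=> tr fin.
have moc a b : measurable (oc a b) by exact: measurable_itv.
have mono a b c d : c <= a -> b <= d -> (mu (oc a b) <= mu (oc c d))%E.
  move=> ca bd; apply: le_measure; rewrite ?inE//.
  by apply: subset_itv; rewrite bnd_simp.
have add a b c : a <= b <= c -> mu (oc a c) = (mu (oc a b) + mu (oc b c))%E.
  move=> /andP[ab bc]; rewrite -measureU//.
    congr (mu _); apply/seteqP; split=> [x|x []]; rewrite /= !in_itv/=.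
    - move=> /andP[ax xc]; have [xb|bx] := leP x b; first by left; rewrite ax.
      by right; rewrite xc.
    - by move=> /andP[-> /le_trans->].
    - by move=> /andP[/(le_lt_trans ab)-> ->].
  apply/seteqP; split=> // x [] /=; rewrite !in_itv/=.
  by move=> /andP[_ xb] /andP[]; rewrite ltNge xb.
have cE : mu (oc 0 1) = (fine (mu (oc 0 1)))%:E by rewrite fineK// ge0_fin_numE.
set c := fine _ in cE; have c0 : 0 <= c by rewrite fine_ge0.
have rat N k : mu (oc 0 (k%:R * N.+1%:R^-1)) = (k%:R * fine (mu (oc 0 N.+1%:R^-1)))%:E.
  have N0 : 0 <= N.+1%:R^-1 :> R by rewrite invr_ge0.
  have finN : mu (oc 0 N.+1%:R^-1) = (fine (mu (oc 0 N.+1%:R^-1)))%:E.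
    rewrite fineK// ge0_fin_numE//; apply: le_lt_trans (mono _ _ 0 1 _ _) _ => //.
    by rewrite invf_le1// ?ler1n// ltr0n.
  elim: k => [|k IH]; first by rewrite !mul0r set_itvoc0 measure0.
  rewrite (add _ (k%:R * N.+1%:R^-1)); last first.
    by rewrite mulr_ge0//= ler_wpM2r// ler_nat.
  rewrite IH -[k.+1%:R]natr1 !mulrDl !mul1r EFinD -finN; congr (_ + _)%E.
  by rewrite -[RHS](tr _ _ (k%:R / N.+1%:R)) add0r addrC.
have ratc N : fine (mu (oc 0 N.+1%:R^-1)) = c / N.+1%:R.
  have := rat N N.+1; rewrite divff ?pnatr_eq0// cE => -[->].
  by rewrite mulrAC divff ?mul1r// pnatr_eq0.
have oc0 s : 0 <= s -> mu (oc 0 s) = (c * s)%:E.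
  move=> s0.
  have bnd N : ((c * s - c / N.+1%:R)%:E <= mu (oc 0 s) <= (c * s + c / N.+1%:R)%:E)%E.
    have N0 : 0 < N.+1%:R :> R by rewrite ltr0n.
    have sN : 0 <= s * N.+1%:R by rewrite mulr_ge0.
    have /andP[k1 k2] := truncn_itv sN; set k := Num.trunc _ in k1 k2.
    have l1 : k%:R * N.+1%:R^-1 <= s by rewrite ler_pdivrMr.
    have l2 : s <= k.+1%:R * N.+1%:R^-1 by rewrite ler_pdivlMr// ltW.
    apply/andP; split.
      apply: le_trans (mono _ _ _ _ (lexx 0) l1); rewrite rat ratc lee_fin.
      have -> : k%:R * (c / N.+1%:R) = c * (k.+1%:R * N.+1%:R^-1) - c / N.+1%:R.
        by rewrite -[k.+1%:R]natr1; ring.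
      by rewrite lerD2r ler_wpM2l.
    apply: le_trans (mono _ _ _ _ (lexx 0) l2) _; rewrite rat ratc lee_fin.
    have -> : k.+1%:R * (c / N.+1%:R) = c * (k%:R * N.+1%:R^-1) + c / N.+1%:R.
      by rewrite -[k.+1%:R]natr1; ring.
    by rewrite lerD2r ler_wpM2l.
  have small e : 0 < e -> exists N, c / N.+1%:R <= e.
    move=> e0; have ec0 : 0 < e / (c + 1) by rewrite divr_gt0// ltr_wpDl.
    have [N] := ltr_add_invr ec0; rewrite add0r ltr_pdivlMr ?ltr_wpDl// => h.
    exists N; rewrite mulrC; apply: le_trans (ltW h); rewrite ler_wpM2l ?invr_ge0//.
    by rewrite lerDl.
  apply/eqP; rewrite eq_le; apply/andP; split.
    apply/lee_addgt0Pr => e /small[N hN]; have /andP[_ h] := bnd N.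
    by apply: le_trans h _; rewrite -EFinD lee_fin lerD2l.
  apply/lee_addgt0Pr => e /small[N hN]; have /andP[h _] := bnd N.
  have := leeD2r e%:E h; apply: le_trans; rewrite -EFinD lee_fin.
  by rewrite -addrA lerDl addrC subr_ge0.
have ocE a b : a < b -> mu (oc a b) = (c%:E * leb (oc a b))%E.
  move=> ab; rewrite lebesgue_measure_itv /= lte_fin ab -EFinB -EFinM -oc0 ?subr_ge0 ?ltW//.
  by rewrite -(tr 0 (b - a) a) add0r subrK.
move=> A mA; rewrite cE.
suff : forall X, measurable X -> mu X = (mscale (NngNum c0) leb) X by move=> /(_ _ mA)->.
have U := (@measure_unique _ R (measurableTypeR R) (@ocitv R) (fun k => oc (- k%:R) k%:R) erefl
  (@ocitvI R) _ _ mu (mscale (NngNum c0) leb)).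
apply: U => //.
- by move=> k; exists (- k%:R, k%:R).
- apply/seteqP; split=> // x _.
  have /andP[_ h] := truncn_itv (normr_ge0 x).
  exists (Num.trunc `|x|).+1 => //; rewrite /= in_itv/=.
  by move: h; rewrite ltr_norml => /andP[-> /ltW].
- move=> _ /ocitvP[->|[[a b] /= ab ->]]; first by rewrite !measure0.
  by rewrite ocE.
- move=> k; case: k => [|k]; first by rewrite oppr0 set_itvoc0 measure0.
  rewrite ocE ?lebesgue_measure_itv /=; last by rewrite gtrN// ltr0n.
  by rewrite lte_fin gtrN ?ltr0n// -EFinB -EFinM ltry.
Qed.

End TranslationInvariance.

(** * Fubini's theorem along a family of parallel lines *)

Section LineProjection.
Context {R : realType} {n : nat}.
Variable u : 'rV[R]_n.
Hypothesis u1 : enorm u = 1.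
Implicit Types (x y z : 'rV[R]_n) (s t : R).

Definition hproj y : 'rV[R]_n := y - dot y u *: u.

Lemma dot_unit : dot u u = 1.
Proof. by rewrite -sqr_enorm u1 expr1n. Qed.

Lemma hprojK y : hproj y + dot y u *: u = y.
Proof. by rewrite /hproj subrK. Qed.

Lemma dot_hproj y : dot (hproj y) u = 0.
Proof. by rewrite /hproj dotBl dotZl dot_unit mulr1 subrr. Qed.

Lemma dot_shift y t : dot (y + t *: u) u = dot y u + t.
Proof. by rewrite dotDl dotZl dot_unit mulr1. Qed.

Lemma hproj_shift y t : hproj (y + t *: u) = hproj y.
Proof. by rewrite /hproj dot_shift scalerDl opprD addrACA subrr addr0. Qed.

Lemma hproj_id x : perp u x -> hproj x = x.
Proof. by rewrite /perp /= /hproj => ->; rewrite scale0r subr0. Qed.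

Lemma hproj_perp_shift x t : perp u x -> hproj (x + t *: u) = x.
Proof. by move=> xu; rewrite hproj_shift hproj_id. Qed.

Lemma dot_perp_shift x t : perp u x -> dot (x + t *: u) u = t.
Proof. by rewrite /perp /= => xu; rewrite dot_shift xu add0r. Qed.

Lemma hprojB y z : hproj (y - z) = hproj y - hproj z.
Proof. by rewrite /hproj dotBl scalerBl !opprD !opprK addrACA. Qed.

Lemma sqr_enorm_shift x t : perp u x -> enorm (x + t *: u) ^+ 2 = enorm x ^+ 2 + t ^+ 2.
Proof.
rewrite /perp /= => xu; rewrite !sqr_enorm dotDl !dotDr !dotZl !dotZr dot_unit.
by rewrite (dotC u x) xu; ring.
Qed.

Lemma enorm_hproj_le y : enorm (hproj y) <= enorm y.
Proof.
rewrite -ler_sqr ?nnegrE ?enorm_ge0// -{2}(hprojK y) sqr_enorm_shift ?lerDl ?sqr_ge0//.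
exact: dot_hproj.
Qed.

Lemma dot_le_enorm y : `|dot y u| <= enorm y.
Proof. by have := dot_le y u; rewrite u1 mulr1. Qed.

Lemma hproj_continuous : continuous hproj.
Proof.
apply: (@elipschitz_continuousV _ _ _ _ 1) => y z.
by rewrite mul1r -hprojB enorm_hproj_le.
Qed.

End LineProjection.

Section Translations.
Context {R : realType} {n : nat}.

Lemma hausdorff_translate k (A : set 'rV[R]_n) v :
  hausdorff k.+1 (translate A v) = hausdorff k.+1 A.
Proof.
have le (B : set 'rV[R]_n) w : (hausdorff k.+1 (translate B w) <= hausdorff k.+1 B)%E.
  apply: le_trans (hausdorff_lip (s := 1) _ _ _) _ => //; last by rewrite expr1n mul1e.
  by move=> x y _ _; rewrite opprD addrACA subrr addr0 mul1r.
apply/eqP; rewrite eq_le le /=.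
apply: le_trans (le (translate A v) (- v)); apply: le_hausdorff => x Ax.
by exists (x + v); [exists x|rewrite addrK].
Qed.

End Translations.

Definition eopen_ball {R : realType} {n} (x : 'rV[R]_n) (r : R) : set 'rV[R]_n :=
  [set y | enorm (y - x) < r].

(** A point [x + t u] lies in an open set iff, for some rational [q] close to [t],
    the point [x + q u] does so with some room; this writes the preimage of the
    open set as a countable union of rectangles. *)
Lemma measurable_line_map (R : realType) (n : nat) (u : 'rV[R]_n) : enorm u = 1 ->
  measurable_fun setT (fun p : (borel_rV R n * measurableTypeR R)%type =>
    (p.1 + p.2 *: u : borel_rV R n)).
Proof.
move=> u1.
apply: (@measurability _ _ (borel_rV R n * measurableTypeR R)%type (borel_rV R n) setT
   (fun p => p.1 + p.2 *: u) (@open 'rV[R]_n)) => // _ [G oG <-]; rewrite setTI.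
have [e [e0 esmall]] : exists e : nat -> R,
    (forall j, 0 < e j) /\ (forall r, 0 < r -> exists j, e j < r).
  exists (fun j => j.+1%:R^-1); split=> [j|r r0]; first by rewrite invr_gt0.
  by have [j] := ltr_add_invr r0; rewrite add0r; exists j.
pose inner j : set 'rV[R]_n := [set y | eopen_ball y (e j) `<=` G].
have cinner j : closed (inner j).
  rewrite -[inner j]setCK; apply: open_closedC.
  apply/open_enormP => y /= /existsNP[z /not_implyP[yz Gz]].
  exists ((e j - enorm (z - y)) / 2).
    by rewrite divr_gt0// subr_gt0.
  move=> y' y'y /(_ z) h; apply: Gz; apply: h.
  move: yz y'y; rewrite /eopen_ball /eball /= => yz y'y.
  have := ler_enormB z y y'; rewrite (enormBC y y'); lra.
pose P (q : rat) (j : nat) : set (borel_rV R n * measurableTypeR R) :=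
  [set x | inner j (x + ratr q *: u)] `*` `]ratr q - e j, ratr q + e j[%classic.
have -> : (fun p : borel_rV R n * measurableTypeR R => p.1 + p.2 *: u) @^-1` G =
    \bigcup_(q in [set: rat]) \bigcup_j P q j.
  apply/seteqP; split=> [[x t] /= Gxt|[x t] [q _ [j _ [/= h1 h2]]]].
    have [r r0 rG] := (open_enormP G).1 oG _ Gxt.
    have r20 : 0 < r / 2 by rewrite divr_gt0.
    have [j jr] := esmall _ r20; have ej := e0 j.
    have tt : t - e j < t + e j by lra.
    have [q] := rat_in_itvoo tt.
    rewrite in_itv/= => /andP[q1 q2].
    exists q => //; exists j => //; split => /=.
      move=> y; rewrite /eopen_ball /= => yx; apply: rG; rewrite /eball /=.
      have := ler_enormB y (x + ratr q *: u) (x + t *: u).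
      have -> : x + ratr q *: u - (x + t *: u) = (ratr q - t) *: u.
        by rewrite opprD addrACA subrr add0r scalerBl.
      rewrite enormZ u1 mulr1.
      have : `|ratr q - t| <= e j by rewrite ler_norml; apply/andP; split; lra.
      lra.
    by rewrite in_itv/=; apply/andP; split; lra.
  apply: h1; rewrite /eopen_ball /=.
  rewrite opprD addrACA subrr add0r -scalerBl enormZ u1 mulr1.
  by move: h2; rewrite in_itv/= => /andP[h2 h3]; rewrite ltr_norml; apply/andP; split; lra.
apply: countable_bigcupT_measurable => // q; apply: bigcupT_measurable => j.
apply: measurableX; last exact: measurable_itv.
apply: closed_borel; apply: closed_comp (cinner j) => x _.
apply: (@elipschitz_continuousV _ _ _ _ 1) => y z.
by rewrite opprD addrACA subrr addr0 mul1r.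
Qed.

Section Fubini.
Context {R : realType} {n : nat}.
Variable u : 'rV[R]_n.+1.
Hypothesis u1 : enorm u = 1.
Implicit Types (x y z : 'rV[R]_n.+1) (s t : R).
Local Notation X := (borel_rV R n.+1).
Local Notation RR := (measurableTypeR R).
Local Notation leb := (@lebesgue_measure R).
Local Notation oc a b := (`]a%R, b%R]%classic : set RR).

Lemma measurable_proj : measurable_fun setT (hproj u : X -> X).
Proof. by apply: continuous_borel; exact: hproj_continuous. Qed.

Lemma measurable_dot : measurable_fun setT ((fun y => dot y u) : X -> RR).
Proof. by apply: continuous_borelR; exact: dot_continuous. Qed.

Lemma measurable_proj_preimage (W : set X) : measurable W -> measurable (hproj u @^-1` W : set X).
Proof. by move=> mW; rewrite -[X in measurable X]setTI; exact: measurable_proj. Qed.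

Definition split_line (y : X) : (X * RR)%type := (hproj u y, dot y u).

Lemma measurable_split_line : measurable_fun setT split_line.
Proof. exact: (measurable_fun_pair measurable_proj measurable_dot). Qed.

Definition split_measure : {measure set (X * RR)%type -> \bar R} :=
  measure_function_pushforward__canonical__measure_function_Measure
    (hausdorffB n) measurable_split_line.

Lemma split_measureE E : split_measure E = hausdorff n.+1 (split_line @^-1` E).
Proof. by []. Qed.

(** The measure on the hyperplane that makes Hausdorff measure a product: the
    measure of a base is the measure of the cylinder of height one above it.
    It lives on the whole space, but only sees the hyperplane. *)
Definition base_measure (W : set X) : \bar R := split_measure (W `*` oc 0 1).

Lemma base_measureE W :
  base_measure W = hausdorff n.+1 [set y | W (hproj u y) /\ 0 < dot y u <= 1].
Proof. by rewrite /base_measure split_measureE; congr hausdorff. Qed.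

Let base_measure0 : base_measure set0 = 0%E.
Proof. by rewrite /base_measure set0X measure0. Qed.

Let base_measure_ge0 W : (0 <= base_measure W)%E.
Proof. exact: measure_ge0. Qed.

Let base_measure_sigma_additive : semi_sigma_additive base_measure.
Proof.
move=> F mF tF mUF; rewrite /base_measure.
have -> : (\bigcup_k F k) `*` oc 0 1 = \bigcup_k (F k `*` oc 0 1).
  apply/seteqP; split=> [[x t] /= [[k _ Fk] t01]|[x t] [k _ [/= Fk t01]]].
    by exists k.
  by split=> //; exists k.
apply: measure_semi_sigma_additive => [k||].
- exact: measurableX.
- apply/trivIsetP => i j _ _ ij; rewrite -setXI.
  by move/trivIsetP : tF => /(_ _ _ I I ij) ->; rewrite set0X.
- by apply: bigcupT_measurable => k; exact: measurableX.
Qed.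

HB.instance Definition _ := isMeasure.Build _ _ _ base_measure
  base_measure0 base_measure_ge0 base_measure_sigma_additive.

Lemma base_measure_eball_fin (r : R) : (base_measure (eball 0 r) < +oo)%E.
Proof.
rewrite base_measureE.
apply: le_lt_trans (le_hausdorff _ _) (hausdorff_eball_fin 0 (r + 1)) => y [].
rewrite /eball /= !subr0 => h /andP[h0 h1]; rewrite -(hprojK u y).
apply: le_trans (ler_enormD _ _) _; rewrite enormZ u1 mulr1 gtr0_norm//.
exact: lerD.
Qed.

Lemma bigcup_eball m : \bigcup_k (eball (0 : 'rV[R]_m) k%:R) = setT.
Proof.
apply/seteqP; split=> // y _.
have /andP[_ /ltW h] := truncn_itv (enorm_ge0 y).
by exists (Num.trunc (enorm y)).+1 => //; rewrite /eball /= subr0.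
Qed.

Let base_measure_sigma_finite : sigma_finite setT base_measure.
Proof.
exists (fun k => eball 0 k%:R); first by rewrite bigcup_eball.
move=> k; split; last exact: base_measure_eball_fin.
by apply: closed_borel; exact: closed_eball.
Qed.

HB.instance Definition _ := Measure_isSigmaFinite.Build _ _ _ base_measure
  base_measure_sigma_finite.

Lemma split_measure_bounded W B : measurable W -> measurable B ->
  (base_measure W < +oo)%E -> split_measure (W `*` B) = (base_measure W * leb B)%E.
Proof.
move=> mW mB fin.
have mPW := measurable_proj_preimage mW.
pose nu : {measure set RR -> \bar R} :=
  measure_function_pushforward__canonical__measure_function_Measure
    (mrestr (hausdorffB n) mPW) measurable_dot.
have nuE C : nu C = split_measure (W `*` C).
  rewrite split_measureE; change (nu C) with
    (hausdorff n.+1 (((fun y => dot y u) @^-1` C) `&` (hproj u @^-1` W))).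
  by rewrite setIC.
rewrite -nuE /base_measure -nuE; apply: translation_invariant_measure => //; last first.
  by rewrite nuE.
move=> a b s; rewrite !nuE !split_measureE.
rewrite -(hausdorff_translate n (split_line @^-1` (W `*` oc a b)) (s *: u)).
congr hausdorff; apply/seteqP; split=> [y [/= Wy]|_ [y [/= Wy yab] <-]].
  rewrite in_itv/= => /andP[h1 h2].
  exists (y - s *: u); last by rewrite subrK.
  rewrite -scaleNr; split=> /=; first by rewrite hproj_shift.
  by rewrite dot_shift// in_itv/=; apply/andP; split; lra.
move: yab; rewrite in_itv/= => /andP[h1 h2].
split=> /=; first by rewrite hproj_shift.
by rewrite dot_shift// in_itv/=; apply/andP; split; lra.
Qed.

(** Cylinders over an unbounded base or with an unbounded height are handled
    by exhaustion. *)
Lemma split_measure_rect W B : measurable W -> measurable B ->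
  split_measure (W `*` B) = (base_measure W * leb B)%E.
Proof.
move=> mW mB.
pose F k : set X := eball 0 k%:R.
have mF k : measurable (F k) by apply: closed_borel; exact: closed_eball.
pose WN k := W `&` seqDU F k.
have mWN k : measurable (WN k).
  apply: measurableI => //; apply: measurableD => //.
  by apply: bigsetU_measurable => i _.
have UW : \bigcup_k WN k = W.
  by rewrite /WN -setI_bigcupr -seqDU_bigcup_eq bigcup_eball setIT.
have tW : trivIset setT WN by apply: trivIset_setIl; exact: trivIset_seqDU.
have finWN k : (base_measure (WN k) < +oo)%E.
  apply: le_lt_trans (base_measure_eball_fin k%:R).
  by apply: le_measure; [rewrite inE; exact: mWN|rewrite inE; exact: (mF k)|move=> y [_ []]].
have sumW : base_measure W = (\sum_(k <oo) base_measure (WN k))%E.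
  by rewrite -[in LHS]UW measure_bigcup//; apply: eq_eseriesl => k; rewrite in_setT.
have sumWB C : measurable C ->
    split_measure (W `*` C) = (\sum_(k <oo) split_measure (WN k `*` C))%E.
  move=> mC; rewrite -[in LHS]UW.
  have -> : (\bigcup_k WN k) `*` C = \bigcup_k (WN k `*` C).
    apply/seteqP; split=> [[x t] /= [[k _ Fk] t01]|[x t] [k _ [/= Fk t01]]].
      by exists k.
    by split=> //; exists k.
  rewrite measure_bigcup.
  - by apply: eq_eseriesl => k; rewrite in_setT.
  - by move=> k _; exact: measurableX.
  - apply/trivIsetP => i j _ _ ij; rewrite -setXI.
    by move/trivIsetP : tW => /(_ _ _ I I ij) ->; rewrite set0X.
(* bounded heights: the factor is a real number and can be taken out *)
have bnd C : measurable C -> (leb C < +oo)%E ->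
    split_measure (W `*` C) = (base_measure W * leb C)%E.
  move=> mC Cfin; rewrite sumWB// sumW.
  have lE : leb C = (fine (leb C))%:E by rewrite fineK// ge0_fin_numE.
  rewrite lE muleC -nneseriesZl; last by move=> k _; exact: measure_ge0.
  by apply: eq_eseriesr => k _; rewrite -lE muleC split_measure_bounded.
have [Wfin|Winf] := ltP (base_measure W) +oo%E; first exact: split_measure_bounded.
move: Winf; rewrite leye_eq => /eqP Winf.
have [Bfin|Binf] := ltP (leb B) +oo%E; first exact: bnd.
move: Binf; rewrite leye_eq => /eqP Binf.
rewrite Winf Binf mulyy; apply/eqP; rewrite -leye_eq.
pose G k : set RR := B `&` `[- k%:R, k%:R]%classic.
have mG k : measurable (G k) by apply: measurableI => //; exact: measurable_itv.
have Gfin k : (leb (G k) < +oo)%E.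
  apply: (@le_lt_trans _ _ (leb `[- k%:R, k%:R]%classic)).
    by apply: le_measure; [rewrite inE; exact: mG|rewrite inE; exact: measurable_itv|move=> x []].
  by rewrite lebesgue_measure_itv /=; case: ifP => _; rewrite -?EFinB ltry.
have [k Gk] : exists k, leb (G k) != 0%E.
  apply: contrapT => /forallNP h.
  have : leb B = 0%E.
    apply/eqP; rewrite eq_le measure_ge0 andbT.
    apply: le_trans (measure_sigma_subadditive leb mG mB _) _.
      move=> x Bx; have /andP[_ /ltW h1] := truncn_itv (normr_ge0 x).
      exists (Num.trunc `|x|).+1 => //; split=> //=.
      by rewrite in_itv/= -ler_norml.
    by rewrite eseries0// => k _ _; apply/eqP/negPn/negP/h.
  by rewrite Binf.
apply: (@le_trans _ _ (split_measure (W `*` G k))).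
  rewrite bnd// Winf gt0_mulye//.
  by rewrite lt_neqAle eq_sym Gk measure_ge0.
apply: le_measure; rewrite ?inE; [exact: measurableX|exact: measurableX|].
by move=> [x t] [/= Wx [Bt _]].
Qed.

Definition line_section (A : set 'rV[R]_n.+1) x : set RR := [set t | A (x + t *: u)].

Lemma measurable_line_preimage (A : set X) : measurable A ->
  measurable [set p : (X * RR)%type | A (p.1 + p.2 *: u)].
Proof. by move=> mA; rewrite -[X in measurable X]setTI; exact: measurable_line_map. Qed.

Lemma line_section_xsection (A : set X) x :
  line_section A x = xsection [set p : (X * RR)%type | A (p.1 + p.2 *: u)] x.
Proof. by rewrite xsectionE. Qed.

Lemma measurable_line_section (A : set X) x : measurable A -> measurable (line_section A x).
Proof.
move=> mA; rewrite line_section_xsection; apply: measurable_xsection.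
exact: measurable_line_preimage.
Qed.

Lemma measurable_section_length (A : set X) : measurable A ->
  measurable_fun setT (fun x : X => leb (line_section A x)).
Proof.
move=> mA; under eq_fun do rewrite line_section_xsection.
by apply: measurable_fun_xsection; exact: measurable_line_preimage.
Qed.

(** Cutting space into lines splits Hausdorff measure into the base measure and
    Lebesgue measure, because the two agree on rectangles: above a fixed base,
    the measure is invariant under translations along the lines. *)
Lemma hausdorff_fubini (A : set X) : measurable A ->
  (hausdorff n.+1 A = \int[base_measure]_x leb (line_section A x))%E.
Proof.
move=> mA.
have -> : hausdorff n.+1 A = split_measure [set p : (X * RR)%type | A (p.1 + p.2 *: u)].
  rewrite split_measureE; congr hausdorff.
  by apply/seteqP; split=> y /=; rewrite hprojK.
rewrite -(product_measure_unique split_measure_rect (measurable_line_preimage mA)).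
by apply: eq_integral => x _; rewrite /= line_section_xsection.
Qed.

End Fubini.

(** * Null sets and their sections *)

Section LinePreimage.
Context {R : realType} {n : nat}.
Variable u : 'rV[R]_n.
Hypothesis u1 : enorm u = 1.
Local Notation RR := (measurableTypeR R).
Local Notation leb := (@lebesgue_measure R).

(** On a line, one-dimensional Hausdorff measure is translation invariant and
    finite on segments, so it is a multiple of Lebesgue measure. *)
Lemma hausdorff1_line_eq0 x (S : set RR) : measurable S -> leb S = 0%E ->
  hausdorff 1 [set x + t *: u | t in S] = 0%E.
Proof.
move=> mS S0.
pose L : set (borel_rV R n) := [set y | hproj u y = hproj u x].
have mL : measurable L.
  apply: closed_borel; have -> : L = (fun y => enorm (hproj u y - hproj u x)) @^-1` [set 0].
    apply/seteqP; split=> y /=; first by move=> ->; rewrite subrr enorm0.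
    by move=> /enorm_eq0/eqP; rewrite subr_eq0 => /eqP.
  apply: closed_comp; last exact: closed_eq.
  move=> y _; apply: (@elipschitz_continuous _ _ _ _ 1) => z w.
  apply: le_trans (enorm_lip _ _) _.
  have -> : hproj u z - hproj u x - (hproj u w - hproj u x) = hproj u (z - w).
    rewrite hprojB; move: (hproj u z) (hproj u w) (hproj u x) => a b c.
    by rewrite opprB addrA subrK.
  rewrite mul1r.
  exact: enorm_hproj_le.
have mf : measurable_fun setT ((fun y => dot y u - dot x u) : borel_rV R n -> RR).
  apply: continuous_borelR; apply: (@elipschitz_continuous _ _ _ _ 1) => y z.
  have -> : dot y u - dot x u - (dot z u - dot x u) = dot (y - z) u by rewrite dotBl; ring.
  by rewrite mul1r; exact: dot_le_enorm.
pose mu : {measure set RR -> \bar R} :=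
  measure_function_pushforward__canonical__measure_function_Measure
    (mrestr (hausdorffB 0) mL) mf.
have muE (C : set RR) : mu C = hausdorff 1 [set x + t *: u | t in C].
  change (mu C) with (hausdorff 1 (((fun y => dot y u - dot x u) @^-1` C) `&` L)).
  congr hausdorff; apply/seteqP; split=> [y [/= Cy Ly]|_ [t Ct <-]].
    exists (dot y u - dot x u) => //; rewrite -[RHS](hprojK u y) Ly scalerBl.
    by rewrite addrA addrAC; congr (_ + _).
  split; rewrite /= ?dot_shift// ?[_ + t]addrC ?addrK//.
  by rewrite /L /= hproj_shift.
rewrite -muE translation_invariant_measure ?S0 ?mule0//.
- move=> a b s; rewrite !muE -(hausdorff_translate 0 [set x + t *: u | t in `]a, b]%classic] (s *: u)).
  congr hausdorff; apply/seteqP; split=> [_ [t /= tab <-]|_ [_ [t tab <-] <-]].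
    exists (x + (t - s) *: u); last by rewrite -addrA -scalerDl subrK.
    exists (t - s) => //; move: tab; rewrite /= !in_itv/= => /andP[h1 h2].
    by apply/andP; split; lra.
  exists (t + s); last by rewrite scalerDl addrA.
  by move: tab; rewrite /= !in_itv/= => /andP[h1 h2]; apply/andP; split; lra.
- rewrite muE; apply: le_lt_trans (hausdorff1_segment_fin x u1); apply: le_hausdorff.
  move=> _ [t /= t01 <-]; exists x => //; exists t => //.
  by move: t01; rewrite /= !in_itv/= => /andP[/ltW-> ->].
Qed.

Lemma line_section_image (A : set 'rV[R]_n) x :
  A `&` translate (axis u) x = [set x + t *: u | t in [set t | A (x + t *: u)]].
Proof.
apply/seteqP; split=> [y [Ay [_ [t _ <-] yE]]|_ [t At <-]].
  by exists t; rewrite /= ?[x + _]addrC// yE.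
by split=> //; exists (t *: u); [exists t|rewrite addrC].
Qed.

End LinePreimage.

Section NullSections.
Context {R : realType} {n : nat}.
Variable u : 'rV[R]_n.+2.
Hypothesis u1 : enorm u = 1.
Implicit Types (x y z : 'rV[R]_n.+2) (s t : R).
Local Notation X := (borel_rV R n.+2).
Local Notation RR := (measurableTypeR R).
Local Notation leb := (@lebesgue_measure R).
Local Notation base := (base_measure u1).

Lemma base_measure_perp (W : set X) : base W = base (W `&` perp u).
Proof.
rewrite !base_measureE; congr hausdorff; apply/seteqP; split=> y [].
  by move=> Wy h; split=> //; split=> //; exact: dot_hproj.
by move=> [Wy _].
Qed.

Lemma closed_perp : closed (perp u).
Proof.
have -> : perp u = (fun y => dot y u) @^-1` [set 0] by [].
by apply: closed_comp; [move=> y _; exact: dot_continuous|exact: closed_eq].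
Qed.

(** The base measure is that of the set swept by [W], up to the bottom face;
    sweeping preserves null sets in both directions. *)
Lemma base_measure_eq0 (W : set X) : measurable W -> W `<=` perp u ->
  base W = 0%E <-> hausdorff n.+1 W = 0%E.
Proof.
move=> mW Wu; split=> W0.
  apply: (hausdorff_sweep_eq0 u1 Wu).
  have m01 : measurable (`[0, 1]%classic : set RR) by exact: measurable_itv.
  apply/eqP; rewrite eq_le hausdorff_ge0 andbT.
  apply: (@le_trans _ _ (split_measure u1 (W `*` `[0, 1]%classic))).
    rewrite split_measureE; apply: le_hausdorff => _ [w Ww [t t01 <-]].
    by split=> /=; rewrite ?hproj_perp_shift ?dot_perp_shift//; exact: Wu.
  by rewrite split_measure_rect// W0 mul0e.
apply/eqP; rewrite eq_le measure_ge0 andbT base_measureE.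
rewrite -(hausdorff_sweep0 u1 W0); apply: le_hausdorff => y [Wy /andP[/ltW y0 y1]].
exists (hproj u y) => //; exists (dot y u); last exact: hprojK.
by rewrite /= in_itv/= y0.
Qed.

(** A Borel hull of [A] is null as well, hence almost all its sections have
    length zero; length zero implies linear Hausdorff measure zero. *)
Lemma hausdorff_null_sections (A : set 'rV[R]_n.+2) : hausdorff n.+2 A = 0%E ->
  hausdorff_ae_in n.+1 (perp u) (fun x => hausdorff 1 (A `&` translate (axis u) x) = 0%E).
Proof.
move=> A0; have [G [mG AG GA]] := hausdorff_hull n.+1 A.
pose f x := leb (line_section u G x).
have mf := measurable_section_length u1 mG.
have : (\int[base]_x `|f x| = 0)%E.
  rewrite -A0 -GA (hausdorff_fubini u1 mG).
  by apply: eq_integral => x _; rewrite gee0_abs.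
move/(ae_eq_integral_abs base measurableT mf) => [N [mN N0 subN]].
have NP : hausdorff n.+1 (N `&` perp u) = 0%E.
  apply/base_measure_eq0; [|by move=> x []|by rewrite -base_measure_perp].
  by apply: measurableI => //; apply: closed_borel; exact: closed_perp.
apply/eqP; rewrite eq_le hausdorff_ge0 andbT -[leRHS]NP; apply: le_hausdorff => x [xu hx].
split=> //; apply: subN => /= h; apply: hx.
apply/eqP; rewrite eq_le hausdorff_ge0 andbT.
rewrite -(hausdorff1_line_eq0 u1 x (measurable_line_section u1 x mG) (h I)).
apply: le_hausdorff; rewrite line_section_image => _ [t At <-].
by exists t => //; exact: AG.
Qed.

(** By Fubini.  The set where the two section lengths differ is Borel and lies in
    [N], so that it is null for the base measure as well. *)
Lemma hausdorff_eq_sections (A B : set 'rV[R]_n.+2) (N : set 'rV[R]_n.+2) :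
  measurable (A : set X) -> measurable (B : set X) -> hausdorff n.+1 N = 0%E ->
  (forall x, perp u x -> ~ N x -> leb (line_section u A x) = leb (line_section u B x)) ->
  hausdorff n.+2 A = hausdorff n.+2 B.
Proof.
move=> mA mB N0 h; rewrite !(hausdorff_fubini u1)//.
have mfA := measurable_section_length u1 mA.
have mfB := measurable_section_length u1 mB.
apply: ge0_ae_eq_integral => //.
pose W : set X := perp u `&` [set x | leb (line_section u A x) != leb (line_section u B x)].
have mperp : measurable (perp u : set X) by apply: closed_borel; exact: closed_perp.
have mW : measurable W.
  apply: measurableI => //.
  rewrite -[X in measurable X]setTI; exact: (@measurable_neqe _ X R setT measurableT _ _ mfA mfB).
have W0 : base W = 0%E.
  apply/base_measure_eq0 => //; first by move=> x [].
  apply/eqP; rewrite eq_le hausdorff_ge0 andbT -N0; apply: le_hausdorff => x [xu] /=.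
  by move=> /eqP hx; apply: contrapT => xN; apply: hx; exact: h.
exists (W `|` ~` perp u); split.
- by apply: measurableU => //; exact: measurableC.
- rewrite /= base_measure_perp; apply/eqP; rewrite eq_le measure_ge0 andbT -[leRHS]W0.
  apply: (@le_measure _ _ _ base); rewrite ?inE//.
  + by apply: measurableI => //; apply: measurableU => //; exact: measurableC.
  + by move=> x [[]].
- move=> x /= hx; have [xu|xu] := pselect (perp u x); last by right.
  by left; split=> //=; apply/eqP => e; apply: hx.
Qed.

(** A Caratheodory set of finite measure contains a Borel set of full measure, to
    which Fubini applies. *)
Lemma hausdorff_null_of_sections (A : set 'rV[R]_n.+2) :
  (hausdorff n.+2).-caratheodory A -> (hausdorff n.+2 A < +oo)%E ->
  hausdorff_ae_in n.+1 (perp u) (fun x => hausdorff 1 (A `&` translate (axis u) x) = 0%E) ->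
  hausdorff n.+2 A = 0%E.
Proof.
move=> cA Afin hA.
have [G [mG AG GA]] := hausdorff_hull n.+1 A.
have GA0 : hausdorff n.+2 (G `\` A) = 0%E.
  have := cA G; rewrite GA (setIidr AG) -setDE => e.
  have : (hausdorff n.+2 A - hausdorff n.+2 A = hausdorff n.+2 (G `\` A))%E.
    by rewrite {1}e addeAC subee ?add0e// ge0_fin_numE// hausdorff_ge0.
  by rewrite subee// ge0_fin_numE// hausdorff_ge0.
have [Z [mZ GAZ Z0]] := hausdorff_hull n.+1 (G `\` A).
rewrite GA0 in Z0.
have BA : G `\` Z `<=` A.
  by move=> y [Gy Zy]; apply: contrapT => Ay; apply: Zy; exact: GAZ.
have mB : measurable (G `\` Z : set X) by exact: measurableD.
have B0 : hausdorff n.+2 (G `\` Z) = 0%E.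
  rewrite (hausdorff_eq_sections (B := set0) mB _ hA)// ?hausdorff0// => x xu.
  move=> /not_andP[//|/contrapT hx].
  have -> : line_section u set0 x = set0 by [].
  rewrite measure0; apply: (@lebesgue_line_eq0 _ _ x u _ u1); first exact: measurable_line_section.
  apply/eqP; rewrite eq_le hausdorff_ge0 andbT -hx; apply: le_hausdorff.
  rewrite line_section_image => _ [t Bt <-]; exists t => //; exact: BA.
apply/eqP; rewrite eq_le hausdorff_ge0 andbT.
have cov : A `<=` (G `\` Z) `|` Z.
  by move=> y Ay; have [|] := pselect (Z y); [right|left; split=> //; exact: AG].
apply: le_trans (le_hausdorff _ cov) _.
by apply: le_trans (outer_measureU2 _ _ _) _; rewrite /= B0 Z0 adde0.
Qed.

End NullSections.

(** * Convex bodies and their chords *)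

Section ConvexSets.
Context {R : realType} {n : nat}.
Implicit Types (A K : set 'rV[R]_n) (x y z c v : 'rV[R]_n) (s t r : R).

Lemma convex_combP A : convex_set A <->
  forall x y s, A x -> A y -> 0 <= s <= 1 -> A (s *: x + (1 - s) *: y).
Proof.
split=> [h x y s Ax Ay /andP[s0 s1]|h x y l].
  have := h x y (Itv01 s0 s1); rewrite !inE; exact.
rewrite !inE => Ax Ay; have l01 : 0 <= l%:num <= 1 by apply/andP; split.
exact: (h x y l%:num Ax Ay l01).
Qed.

(** The ball around the interior point shrinks along the segment. *)
Lemma interior_segment A c y s : convex_set A -> A° c -> A y -> 0 <= s < 1 ->
  A° (c + s *: (y - c)).
Proof.
move=> /convex_combP cA /interior_enormP[r r0 rA] Ay /andP[s0 s1].
have s10 : 0 < 1 - s by rewrite subr_gt0.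
apply/interior_enormP; exists ((1 - s) * r); first by rewrite mulr_gt0.
move=> z zc; pose w := c + (1 - s)^-1 *: (z - (c + s *: (y - c))).
have -> : z = s *: y + (1 - s) *: w.
  rewrite /w scalerDr scalerA divff ?gt_eqF// scale1r.
  by rewrite addrA addrCA; apply/rowP => i; rewrite !mxE; ring.
apply: cA => //; last by rewrite s0 ltW.
apply: rA; rewrite /w /eball /= [c + _]addrC addrK enormZ ger0_norm ?invr_ge0 ?(ltW s10)//.
by rewrite mulrC ler_pdivrMr// mulrC.
Qed.

Lemma convex_eball x r : convex_set (eball x r).
Proof.
apply/convex_combP => y z s yx zx /andP[s0 s1]; rewrite /eball /=.
have -> : s *: y + (1 - s) *: z - x = s *: (y - x) + (1 - s) *: (z - x).
  by apply/rowP => i; rewrite !mxE; ring.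
apply: le_trans (ler_enormD _ _) _; rewrite !enormZ !ger0_norm ?subr_ge0//.
have -> : r = s * r + (1 - s) * r by ring.
by apply: lerD; rewrite ler_wpM2l ?subr_ge0.
Qed.

Lemma convex_body_eball x r : 0 < r -> convex_body (eball x r).
Proof.
move=> r0; split; last first.
- by exists x; apply/interior_enormP; exists r.
- exact: convex_eball.
- apply/compact_enormP; split; first exact: closed_eball.
  exists (r + enorm x) => y yx; rewrite /eball /= subr0.
  have := ler_enormD (y - x) x; rewrite subrK => /le_trans; apply.
  by rewrite lerD2r.
Qed.

(** Each point of [K] is a limit of interior points, along the segment to one
    fixed interior point. *)
Lemma convex_body_sub_closed K A : convex_body K -> closed A -> K° `<=` A -> K `<=` A.
Proof.
move=> [_ cK [c Kc]] /closed_enormP clA KA y Ky; apply: clA => r r0.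
pose N := enorm (y - c) + 1; have N0 : 0 < N by rewrite ltr_wpDl// enorm_ge0.
pose e := Num.min 1 (r / N).
have e0 : 0 < e by rewrite lt_min ltr01 divr_gt0.
have e1 : e <= 1 by rewrite ge_min lexx.
exists (c + (1 - e) *: (y - c)).
  by apply: KA; apply: interior_segment => //; rewrite subr_ge0 e1 gtrBl.
have -> : c + (1 - e) *: (y - c) - y = - (e *: (y - c)).
  by apply/rowP => i; rewrite !mxE; ring.
rewrite enormN enormZ gtr0_norm//.
apply: (@le_trans _ _ (r / N * N)); last by rewrite divfK// gt_eqF.
by apply: ler_pM; rewrite ?(ltW e0) ?enorm_ge0 ?lerDl// ge_min lexx orbT.
Qed.

End ConvexSets.

Section Chords.
Context {R : realType} {n : nat}.
Variable u : 'rV[R]_n.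
Hypothesis u1 : enorm u = 1.
Implicit Types (A K : set 'rV[R]_n) (x y z c v : 'rV[R]_n) (a b s t r : R).

Lemma line_comb x s a b : s *: (x + a *: u) + (1 - s) *: (x + b *: u) =
  x + (s * a + (1 - s) * b) *: u.
Proof. by apply/rowP => i; rewrite !mxE; ring. Qed.

Lemma line_between A x a b t : convex_set A -> a <= t <= b ->
  A (x + a *: u) -> A (x + b *: u) -> A (x + t *: u).
Proof.
move=> /convex_combP cA /andP[at_ tb] Aa Ab.
have [ab|ba] := ltP a b; last first.
  by have -> : t = a by apply/eqP; rewrite eq_le at_ (le_trans tb).
have ba0 : 0 < b - a by rewrite subr_gt0.
have := cA _ _ ((b - t) / (b - a)) Aa Ab; rewrite line_comb.
have -> : (b - t) / (b - a) * a + (1 - (b - t) / (b - a)) * b = t.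
  by field; rewrite gt_eqF.
by apply; rewrite divr_ge0 ?(ltW ba0) ?subr_ge0//= ler_pdivrMr// mul1r lerD2l lerN2.
Qed.

Lemma enorm_line x s t : enorm (x + s *: u - (x + t *: u)) = `|s - t|.
Proof. by rewrite opprD addrACA subrr add0r -scalerBl enormZ u1 mulr1. Qed.

(** The chord is a compact interval by compactness and convexity; the segments
    from an interior point on the line to its ends stay in the interior. *)
Lemma chord_spec K x : convex_body K -> perp u x -> (exists t, K (x + t *: u)) ->
  exists a b, [/\ a <= b, forall t, K (x + t *: u) <-> a <= t <= b,
    chord_mid K u x = (a + b) / 2
    & (exists s, K° (x + s *: u)) -> a < b /\ forall t, a < t < b -> K° (x + t *: u)].
Proof.
move=> [/compact_enormP[clK [r Kr]] cK _] xu [t0 Kt0].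
pose T := [set t : R | K (x + t *: u)].
have bndT t : T t -> - r <= t <= r.
  move=> /Kr; rewrite /eball /= subr0 => h; rewrite -ler_norml.
  by apply: le_trans h; rewrite -{1}(dot_perp_shift u1 t xu); exact: dot_le_enorm.
have T0 : T !=set0 by exists t0.
have hs : has_sup T by split=> //; exists r => t /bndT /andP[].
have hi : has_inf T by split=> //; exists (- r) => t /bndT /andP[].
have lb t : T t -> inf T <= t by move=> Tt; apply: ge_inf => //; exact: hi.2.
have ub t : T t -> t <= sup T by move=> Tt; apply: ub_le_sup => //; exact: hs.2.
have clT t : (forall e, 0 < e -> exists2 s, T s & `|s - t| <= e) -> T t.
  move=> h; apply: ((closed_enormP K).1 clK) => e /h[s Ts st].
  by exists (x + s *: u) => //; rewrite enorm_line.
have Ta : T (inf T).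
  apply: clT => e e0; have [s Ts se] := inf_adherent e0 hi; exists s => //.
  by rewrite ger0_norm ?subr_ge0 ?lb// lerBlDl ltW.
have Tb : T (sup T).
  apply: clT => e e0; have [s Ts se] := sup_adherent e0 hs; exists s => //.
  by rewrite ler0_norm ?subr_le0 ?ub// opprB lerBlDr -lerBlDl ltW// addrC.
exists (inf T), (sup T); split=> //; first exact: lb.
  by move=> t; split=> [Kt|h]; [rewrite lb// ub|exact: line_between Ta Tb].
move=> [s Ks].
have iS (v q : R) : T v -> 0 <= q < 1 -> K° (x + (s + q * (v - s)) *: u).
  move=> Tv q01; have := interior_segment cK Ks Tv q01.
  have <- // : x + s *: u + q *: (x + v *: u - (x + s *: u)) = x + (s + q * (v - s)) *: u.
  by apply/rowP => i; rewrite !mxE; ring.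
have [e e0 eK] := (interior_enormP _ _).1 Ks.
have Ks1 : T (s + e) by apply: eK; rewrite /eball /= enorm_line; rewrite addrAC subrr add0r gtr0_norm.
have Ks2 : T (s - e) by apply: eK; rewrite /eball /= enorm_line; rewrite addrAC subrr add0r normrN gtr0_norm.
split; first by have := lb _ Ks2; have := ub _ Ks1; lra.
move=> t /andP[h1 h2].
have [lt|gt|->//] := ltgtP t s.
- have sa : 0 < s - inf T by rewrite subr_gt0 (lt_trans h1).
  have := iS _ ((s - t) / (s - inf T)) Ta.
  have -> : s + (s - t) / (s - inf T) * (inf T - s) = t by field; rewrite gt_eqF.
  apply; rewrite divr_ge0 ?(ltW sa) ?subr_ge0 ?(ltW lt)//=.
  by rewrite ltr_pdivrMr// mul1r; lra.
- have bs : 0 < sup T - s by rewrite subr_gt0 (lt_trans gt).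
  have := iS _ ((t - s) / (sup T - s)) Tb.
  have -> : s + (t - s) / (sup T - s) * (sup T - s) = t by field; rewrite gt_eqF.
  apply; rewrite divr_ge0 ?(ltW bs) ?subr_ge0 ?(ltW gt)//=.
  by rewrite ltr_pdivrMr// mul1r; lra.
Qed.

End Chords.

(** * The shaken body *)

(** For a convex body [K] and constant [phi] this is the interior of the Steiner
    symmetral of [K], moved by [phi u]; for the identity it is the interior of [K]. *)
Definition shaken {R : realType} {n} (u : 'rV[R]_n) (phi : R -> R) (K : set 'rV[R]_n) :=
  \bigcup_(t : R) (translate (reflected_section K u t) (phi t *: u))°.

Section Shaken.
Context {R : realType} {n : nat}.
Variable u : 'rV[R]_n.
Hypothesis u1 : enorm u = 1.
Variable phi : R -> R.
Hypothesis hphi : 1.-lipschitz phi.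
Implicit Types (A K L : set 'rV[R]_n) (x y z c v : 'rV[R]_n) (a b s t r : R).

Lemma contraction_le s t : `|phi s - phi t| <= `|s - t|.
Proof. by have := @hphi (s, t) (conj I I); rewrite /= mul1r. Qed.

Lemma reflected_sectionP K t z : reflected_section K u t z <->
  K (z + t *: u) /\ K (z - (t + 2 * dot (z - t *: u) u) *: u).
Proof.
have E w : w - t *: u - (2 * dot (w - t *: u) u) *: u =
    w - (t + 2 * dot (w - t *: u) u) *: u.
  by rewrite scalerDl opprD addrA.
split.
  move=> [[x Kx <-] [_ [y Ky <-] yE]]; rewrite subrK; split=> //.
  rewrite -E -yE addrK; have -> : y - (2 * dot y u) *: u -
      (2 * dot (y - (2 * dot y u) *: u) u) *: u = y => //.
  rewrite dotBl dotZl dot_unit// mulr1.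
  by apply/rowP => i; rewrite !mxE; ring.
rewrite -E => -[K1 K2]; split.
  by exists (z + t *: u) => //; rewrite addrK.
exists (z - t *: u); last by rewrite subrK.
exists (z - t *: u - (2 * dot (z - t *: u) u) *: u) => //.
rewrite [dot (z - t *: u - _) u]dotBl dotZl dot_unit// mulr1.
by apply/rowP => i; rewrite !mxE; ring.
Qed.

(** On a line, the reflection and the two shifts by [t u] amount to the
    reflection of heights in [t]. *)
Lemma reflected_section_line K x t s : perp u x ->
  reflected_section K u t (x + s *: u) <-> K (x + (t + s) *: u) /\ K (x + (t - s) *: u).
Proof.
move=> xu; rewrite reflected_sectionP -addrA -scalerDl [s + t]addrC.
suff -> : x + s *: u - (t + 2 * dot (x + s *: u - t *: u) u) *: u = x + (t - s) *: u by [].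
rewrite dotBl dot_perp_shift// dotZl dot_unit// mulr1.
by apply/rowP => i; rewrite !mxE; ring.
Qed.

Lemma shaken_sub K x r : perp u x -> shaken u phi K (x + r *: u) ->
  exists t, K (x + (t + (r - phi t)) *: u) /\ K (x + (t - (r - phi t)) *: u).
Proof.
move=> xu [t _ /interior_subset[z Kz zE]]; exists t.
apply/reflected_section_line => //.
suff -> : x + (r - phi t) *: u = z by [].
by rewrite scalerBl addrA -zE addrK.
Qed.

(** Conversely, the two conditions are stable under small displacements of the
    point, because the displacement and its mirror image are equally long. *)
Lemma shaken_interior K x t s : perp u x ->
  K° (x + (t + s) *: u) -> K° (x + (t - s) *: u) ->
  shaken u phi K (x + (phi t + s) *: u).
Proof.
move=> xu /interior_enormP[r1 r10 K1] /interior_enormP[r2 r20 K2].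
exists t => //; apply/interior_enormP; exists (Num.min r1 r2).
  by rewrite lt_min r10.
move=> y; rewrite /eball /= le_min => /andP[y1 y2].
exists (y - phi t *: u); last by rewrite subrK.
pose x' := hproj u y; have x'u : perp u x' by exact: dot_hproj.
pose s' := dot y u - phi t.
have yE : y - phi t *: u = x' + s' *: u by rewrite -{1}(hprojK u y) scalerBl addrA.
have dE : y - (x + (phi t + s) *: u) = (x' - x) + (s' - s) *: u.
  by rewrite -{1}(hprojK u y) -/x' /s'; apply/rowP => i; rewrite !mxE; ring.
have pu : perp u (x' - x) by rewrite /perp /= dotBl x'u xu subrr.
rewrite yE; apply/reflected_section_line => //; split.
  apply: K1; rewrite /eball /=.
  have -> : x' + (t + s') *: u - (x + (t + s) *: u) = (x' - x) + (s' - s) *: u.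
    by apply/rowP => i; rewrite !mxE; ring.
  by rewrite -dE.
apply: K2; rewrite /eball /=.
have -> : x' + (t - s') *: u - (x + (t - s) *: u) = (x' - x) + (s - s') *: u.
  by apply/rowP => i; rewrite !mxE; ring.
(* the reflection of the displacement has the same length *)
apply: le_trans y2; rewrite dE -ler_sqr ?nnegrE ?enorm_ge0// !sqr_enorm_shift//.
by rewrite lerD2l -sqrrN opprB.
Qed.

Lemma open_shaken K : open (shaken u phi K).
Proof. by apply: bigcup_open => t _; exact: open_interior. Qed.

Lemma shaken_mono K L : K `<=` L -> shaken u phi K `<=` shaken u phi L.
Proof.
move=> KL y [t _ h]; exists t => //; apply: interiorS h => z [w wK <-].
exists w => //; have /reflected_sectionP[w1 w2] := wK.
by apply/reflected_sectionP; split; exact: KL.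
Qed.

(** Since [phi] is a contraction, every term of the union stays within the
    chord shifted by the displacement of its midpoint [m]; the term at height
    [m] already contains the shifted open chord. *)
Lemma shaken_chord_sub a b x r K : perp u x ->
  (forall t, K (x + t *: u) -> a <= t <= b) -> shaken u phi K (x + r *: u) ->
  a <= r - (phi ((a + b) / 2) - (a + b) / 2) <= b.
Proof.
move=> xu ab /(shaken_sub xu)[t [/ab/andP[h1 h2] /ab/andP[h3 h4]]].
have := contraction_le t ((a + b) / 2).
set m := (a + b) / 2 => h5; have mE : a + b = 2 * m by rewrite /m; field.
have [tm|mt] := leP m t.
  move: h5; rewrite [`|t - m|]ger0_norm ?subr_ge0// ler_norml => /andP[h5 h6].
  by apply/andP; split; lra.
move: h5; rewrite [`|t - m|]ltr0_norm ?subr_lt0// ler_norml => /andP[h5 h6].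
by apply/andP; split; lra.
Qed.

Lemma shaken_chord_sup a b x r K : perp u x ->
  (forall t, a < t < b -> K° (x + t *: u)) ->
  a < r - (phi ((a + b) / 2) - (a + b) / 2) < b -> shaken u phi K (x + r *: u).
Proof.
move=> xu ab; set m := (a + b) / 2 => /andP[h1 h2].
have mE : a + b = 2 * m by rewrite /m; field.
have -> : r = phi m + (r - phi m) by lra.
by apply: shaken_interior => //; apply: ab; apply/andP; split; lra.
Qed.

End Shaken.

Lemma bernoulli_le (R : realType) (e : R) m : 0 <= e <= 1 -> 1 - m%:R * e <= (1 - e) ^+ m.
Proof.
move=> /andP[e0 e1]; elim: m => [|m IH]; first by rewrite mul0r subr0 expr0.
rewrite exprS; apply: (@le_trans _ _ ((1 - e) * (1 - m%:R * e))).
  rewrite -natr1; have : 0 <= m%:R * e * e by rewrite !mulr_ge0.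
  lra.
by rewrite ler_wpM2l// subr_ge0.
Qed.

Section ChordlessLines.
Context {R : realType} {n : nat}.
Variable u : 'rV[R]_n.+2.
Hypothesis u1 : enorm u = 1.
Implicit Types (A K L : set 'rV[R]_n.+2) (x y z c v : 'rV[R]_n.+2) (a b s t r : R).
Local Notation X := (borel_rV R n.+2).
Local Notation leb := (@lebesgue_measure R).

(** Over these points the chord of a convex body lies in its boundary and the
    shaken body misses the shifted chord. *)
Definition tangent_feet K : set 'rV[R]_n.+2 :=
  perp u `&` [set x | (exists t, K (x + t *: u)) /\ ~ exists t, K° (x + t *: u)].

(** The shadow of [K] is contained in the dilate by any factor greater than
    one, about an interior point, of the shadow of the interior; the two
    shadows thus have the same measure. *)
Lemma hausdorff_tangent_feet K : convex_body K -> hausdorff n.+1 (tangent_feet K) = 0%E.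
Proof.
move=> [cptK cK [c Kc]].
have [clK [r Kr]] := (compact_enormP K).1 cptK.
pose W1 : set X := hproj u @` K.
pose W0 : set X := perp u `&` [set x | exists t, K° (x + t *: u)].
have mW1 : measurable W1.
  apply: closed_borel; apply: compact_closed; first exact: norm_hausdorff.
  by apply: continuous_compact => //; apply: continuous_subspaceT; exact: hproj_continuous.
have mW0 : measurable W0.
  apply: measurableI; first by apply: closed_borel; exact: closed_perp.
  apply: open_borel; apply/open_enormP => x [t Kt].
  have [e e0 eK] := (open_enormP K°).1 (open_interior K) _ Kt.
  exists e => // x' x'x; exists t; apply: eK; move: x'x; rewrite /eball /=.
  by rewrite opprD addrACA subrr addr0.
have W01 : W0 `<=` W1.
  move=> x [xu [t /interior_subset Kt]]; exists (x + t *: u) => //.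
  exact: hproj_perp_shift.
have W1u : W1 `<=` perp u by move=> _ [y _ <-]; exact: dot_hproj.
have finW1 : (base_measure u1 W1 < +oo)%E.
  apply: le_lt_trans (base_measure_eball_fin u1 r).
  apply: le_measure; rewrite ?inE//; first by apply: closed_borel; exact: closed_eball.
  move=> _ [y Ky <-]; have := Kr _ Ky; rewrite /eball /= !subr0.
  by apply: le_trans; exact: enorm_hproj_le.
have finW0 : (base_measure u1 W0 < +oo)%E.
  by apply: le_lt_trans finW1; apply: le_measure; rewrite ?inE.
pose g := dot c u.
pose cyl W : set 'rV[R]_n.+2 := split_line u @^-1` (W `*` `]g, g + 1]%classic).
have cylE (W : set X) : measurable W -> hausdorff n.+2 (cyl W) = base_measure u1 W.
  move=> mW; rewrite -split_measureE split_measure_rect//.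
    by rewrite lebesgue_measure_itv /= lte_fin ltrDl ltr01 -EFinB addrAC subrr add0r mule1.
have w1E : base_measure u1 W1 = (fine (base_measure u1 W1))%:E.
  by rewrite fineK// ge0_fin_numE.
have w0E : base_measure u1 W0 = (fine (base_measure u1 W0))%:E.
  by rewrite fineK// ge0_fin_numE.
set w1 := fine _ in w1E; set w0 := fine _ in w0E.
have w10 : 0 <= w1 by rewrite fine_ge0.
have dil s : 0 < s < 1 -> w1 * s ^+ n.+2 <= w0.
  move=> /andP[s0 s1]; have sV : 0 < s^-1 by rewrite invr_gt0.
  have cov : cyl W1 `<=` (fun z => c + s^-1 *: (z - c)) @` cyl W0.
    move=> y [/= [z Kz zy]]; rewrite in_itv/= => /andP[h1 h2].
    exists (c + s *: (y - c)); last first.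
      by rewrite [c + s *: _]addrC addrK scalerA mulVf ?gt_eqF// scale1r addrC subrK.
    have dE : dot (c + s *: (y - c)) u = g + s * (dot y u - g).
      by rewrite dotDl dotZl dotBl.
    split=> /=; last first.
      rewrite in_itv/= dE ltrDl mulr_gt0 ?subr_gt0//= lerD2l.
      by rewrite -[leRHS]mulr1; apply: ler_pM; rewrite ?(ltW s0) ?(ltW s1) ?subr_ge0 ?(ltW h1)// lerBlDl.
    split; first exact: dot_hproj.
    exists (dot (c + s *: (z - c)) u).
    have -> : hproj u (c + s *: (y - c)) = hproj u (c + s *: (z - c)).
      have pE w : hproj u (c + s *: (w - c)) = hproj u c + s *: (hproj u w - hproj u c).
        by rewrite /hproj !(dotDl, dotZl, dotNl); apply/rowP => i; rewrite !mxE; ring.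
      by rewrite !pE zy.
    rewrite hprojK; apply: interior_segment => //.
    by rewrite (ltW s0).
  have lip : (hausdorff n.+2 (cyl W1) <= (s^-1 ^+ n.+2)%:E * hausdorff n.+2 (cyl W0))%E.
    apply: le_trans (le_hausdorff _ cov) _; apply: hausdorff_lip => // y z _ _.
    rewrite opprD addrACA subrr add0r -scalerBr opprB addrA subrK enormZ gtr0_norm//.
  move: lip; rewrite !cylE// w1E w0E -EFinM lee_fin exprVn.
  by rewrite mulrC -ler_pdivlMr ?exprn_gt0// => h; rewrite -ler_pdivlMr ?exprn_gt0.
have w10le : w1 <= w0.
  apply/ler_addgt0Pr => e e0.
  pose N : R := n.+2%:R * w1 + 1; have N0 : 0 < N by rewrite ltr_wpDl// mulr_ge0.
  pose h := Num.min (1 / 2) (e / N).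
  have h0 : 0 < h by rewrite lt_min !divr_gt0.
  have h1 : h <= 1 / 2 by rewrite ge_min lexx.
  have hh : 0 < 1 - h < 1 by apply/andP; split; lra.
  have hb : 0 <= h <= 1 by apply/andP; split; lra.
  have := le_trans (ler_wpM2l w10 (bernoulli_le n.+2 hb)) (dil _ hh).
  have : h * N <= e by rewrite -ler_pdivlMr// ge_min lexx orbT.
  rewrite /N; move: (n.+2%:R : R) => M; lra.
have D0 : base_measure u1 (W1 `\` W0) = 0%E.
  have := @measureD _ _ _ (base_measure u1) W1 W0 mW1 mW0 finW1.
  rewrite /= (setIidr W01) w1E w0E => D.
  by apply/eqP; rewrite eq_le measure_ge0 andbT D -EFinB lee_fin subr_le0.
have : hausdorff n.+1 (W1 `\` W0) = 0%E.
  apply/(base_measure_eq0 u1) => //; first exact: measurableD.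
  by move=> x [/W1u].
move=> h0; apply/eqP; rewrite eq_le hausdorff_ge0 andbT -h0; apply: le_hausdorff.
move=> x [xu [[t Kt] h]]; split; last by case.
by exists (x + t *: u) => //; exact: hproj_perp_shift.
Qed.

End ChordlessLines.

(** * Sections of the shaken body and essential equality *)

Section NullSets.
Context {R : realType} {n : nat}.
Implicit Types (A B C K : set 'rV[R]_n) (x : 'rV[R]_n) (k : nat).

Lemma hausdorff_subset_eq0 k A B : A `<=` B -> hausdorff k B = 0%E -> hausdorff k A = 0%E.
Proof.
by move=> AB B0; apply/eqP; rewrite eq_le hausdorff_ge0 andbT -B0; exact: le_hausdorff.
Qed.

Lemma hausdorff_setU_le k A B : (hausdorff k.+1 (A `|` B) <= hausdorff k.+1 A + hausdorff k.+1 B)%E.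
Proof. exact: outer_measureU2. Qed.

Lemma hausdorff_setU_eq0 k A B : hausdorff k.+1 A = 0%E -> hausdorff k.+1 B = 0%E ->
  hausdorff k.+1 (A `|` B) = 0%E.
Proof.
move=> A0 B0; apply/eqP; rewrite eq_le hausdorff_ge0 andbT.
by apply: le_trans (hausdorff_setU_le _ _ _) _; rewrite A0 B0 adde0.
Qed.

Lemma hausdorff_set1 k x : hausdorff k.+1 [set x] = 0%E.
Proof.
apply/eqP; rewrite eq_le hausdorff_ge0 andbT; apply: hausdorff_leP => d d0.
apply: le_trans (@hausdorff_delta_le_diam _ _ k d [set x] 0 _ _) _.
- by rewrite lexx ltW.
- by move=> _ _ -> ->; rewrite subrr enorm0.
- by rewrite exprS mul0r mulr0.
Qed.

Lemma hausdorff_le_of_setD_eq0 k A B : hausdorff k.+1 (A `\` B) = 0%E ->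
  (hausdorff k.+1 A <= hausdorff k.+1 B)%E.
Proof.
move=> h; have AB : A `<=` (A `\` B) `|` B.
  by move=> x Ax; have [|] := pselect (B x); [right|left].
apply: le_trans (le_hausdorff _ AB) _.
by apply: le_trans (hausdorff_setU_le _ _ _) _; rewrite h add0e.
Qed.

End NullSets.

Section Essentially.
Context {R : realType} {n : nat}.
Implicit Types (A B C K : set 'rV[R]_n.+1) (x : 'rV[R]_n.+1).

Lemma subset_ess_sub A B : A `<=` B -> ess_sub A B.
Proof.
by move=> AB; rewrite /ess_sub (_ : A `\` B = set0) ?hausdorff0// setD_eq0.
Qed.

Lemma ess_eqP A B : ess_eq A B <-> ess_sub A B /\ ess_sub B A.
Proof.
split=> [h|[h1 h2]]; last exact: hausdorff_setU_eq0.
by split; apply: hausdorff_subset_eq0 h => x; [left|right].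
Qed.

Lemma ess_sub_trans B A C : ess_sub A B -> ess_sub B C -> ess_sub A C.
Proof.
move=> h1 h2; apply: hausdorff_subset_eq0 (hausdorff_setU_eq0 h1 h2) => x [Ax Cx].
by have [Bx|Bx] := pselect (B x); [right|left].
Qed.

Lemma ess_eq_sym A B : ess_eq A B -> ess_eq B A.
Proof. by rewrite /ess_eq setYC. Qed.

Lemma ess_eq_trans B A C : ess_eq A B -> ess_eq B C -> ess_eq A C.
Proof.
move=> /ess_eqP[h1 h2] /ess_eqP[h3 h4]; apply/ess_eqP.
by split; [exact: ess_sub_trans h3|exact: ess_sub_trans h2].
Qed.

Lemma ess_eq_hausdorff A B : ess_eq A B -> hausdorff n.+1 A = hausdorff n.+1 B.
Proof.
by move=> /ess_eqP[h1 h2]; apply/eqP; rewrite eq_le !hausdorff_le_of_setD_eq0.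
Qed.

(** Through this lemma the preservation of measure turns a one-sided inclusion
    into an essential equality. *)
Lemma ess_eq_of_sub A B : (hausdorff n.+1).-caratheodory A -> (hausdorff n.+1).-caratheodory B ->
  (hausdorff n.+1 A < +oo)%E -> hausdorff n.+1 A = hausdorff n.+1 B ->
  ess_sub A B -> ess_eq A B.
Proof.
move=> cA cB Afin AB h; apply/ess_eqP; split=> //; rewrite /ess_sub setDE.
have fin : hausdorff n.+1 A \is a fin_num by rewrite ge0_fin_numE// hausdorff_ge0.
have e1 := cA B; have e2 := cB A.
rewrite -!setDE in e1 e2 *; rewrite h adde0 in e2.
rewrite -AB [B `&` A]setIC -e2 in e1.
have : (hausdorff n.+1 A - hausdorff n.+1 A = hausdorff n.+1 (B `\` A))%E.
  by rewrite {1}e1 addeAC subee// add0e.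
by rewrite subee.
Qed.

Lemma convex_body_fin K : convex_body K -> (hausdorff n.+1 K < +oo)%E.
Proof.
move=> [/compact_enormP[_ [r Kr]] _ _].
exact: le_lt_trans (le_hausdorff _ Kr) (hausdorff_eball_fin _ _).
Qed.

(** Nonempty open sets are not null, so the interior of [K] lies in [A], and [K]
    lies in the closure of its interior. *)
Lemma convex_body_ess_sub K A : convex_body K -> closed A -> ess_sub K A -> K `<=` A.
Proof.
move=> cK clA KA; apply: convex_body_sub_closed => // y Ky; apply: contrapT => Ay.
have : (K° `&` ~` A) y by [].
have oKA : open (K° `&` ~` A).
  by apply: openI; [exact: open_interior|exact: closed_openC].
move=> /((open_enormP _).1 oKA)[r r0 h].
have := @hausdorff_eball_neq0 R n y r r0; apply.
by apply: hausdorff_subset_eq0 KA => z /h[/interior_subset Kz Az]; split.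
Qed.

Lemma hausdorff_eball_le x (r : R) : 0 < r ->
  (hausdorff n.+1 (eball x r) <= (r ^+ n.+1)%:E * hausdorff n.+1 (eball (0 : 'rV[R]_n.+1) 1))%E.
Proof.
move=> r0; have sub : eball x r `<=` (fun y => x + r *: y) @` eball 0 1.
  move=> y yx; exists (r^-1 *: (y - x)); last first.
    by rewrite scalerA divff ?gt_eqF// scale1r addrC subrK.
  rewrite /eball /= subr0 enormZ ger0_norm ?invr_ge0 ?(ltW r0)//.
  by rewrite mulrC ler_pdivrMr// mul1r.
apply: le_trans (le_hausdorff _ sub) _; apply: hausdorff_lip => // y z _ _.
by rewrite opprD addrACA subrr add0r -scalerBr enormZ gtr0_norm.
Qed.

Lemma hausdorff_eball_shift (x y : 'rV[R]_n.+1) (r : R) :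
  hausdorff n.+1 (eball x r) = hausdorff n.+1 (eball y r).
Proof.
rewrite -(hausdorff_translate n (eball x r) (y - x)); congr hausdorff.
apply/seteqP; split=> [_ [z zx <-]|z zy].
  rewrite /eball /=; have -> // : z + (y - x) - y = z - x.
  by apply/rowP => i; rewrite !mxE; ring.
exists (z - (y - x)); last by rewrite subrK.
rewrite /eball /=; have -> // : z - (y - x) - x = z - y.
by apply/rowP => i; rewrite !mxE; ring.
Qed.

End Essentially.

Section ShakenMeasure.
Context {R : realType} {n : nat}.
Variable u : 'rV[R]_n.+2.
Hypothesis u1 : enorm u = 1.
Variable phi : R -> R.
Hypothesis hphi : 1.-lipschitz phi.
Implicit Types (A B K L : set 'rV[R]_n.+2) (x y z c v : 'rV[R]_n.+2) (a b s t r : R).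
Local Notation RR := (measurableTypeR R).
Local Notation leb := (@lebesgue_measure R).
Local Notation line x := (translate (axis u) x).
Local Notation shifted_chord K x :=
  (translate (K `&` line x) ((phi (chord_mid K u x) - chord_mid K u x) *: u)).

Lemma lineP A x y : (A `&` line x) y <-> exists2 t, A (x + t *: u) & y = x + t *: u.
Proof.
rewrite line_section_image; split=> [[t At <-]|[t At ->]]; by exists t.
Qed.

(** The shifted open chord lies in the shaken body and the shifted closed chord
    contains its section, so only the two endpoints are in doubt. *)
Lemma shifted_chord_section K x : convex_body K -> perp u x -> ~ tangent_feet u K x ->
  hausdorff 1 ((shaken u phi K `&` line x) `+` shifted_chord K x) = 0%E.
Proof.
move=> cK xu xK.
have [Kx|Kx] := pselect (exists t, K (x + t *: u)); last first.
  rewrite (_ : _ `+` _ = set0) ?hausdorff0//; apply/seteqP; split=> // y.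
  case=> [[/lineP[r Sr _] _]|[[_ /lineP[r Kr _] _] _]]; apply: Kx; last by exists r.
  by have [t [Kt _]] := shaken_sub u1 xu Sr; exists (t + (r - phi t)).
have Kx0 : exists s, K° (x + s *: u) by apply: contrapT => h; apply: xK.
have [a [b [ab Kab -> /(_ Kx0)[ab' Ki]]]] := chord_spec u1 cK xu Kx.
set d := phi _ - _.
apply: (hausdorff_subset_eq0 _ (hausdorff_setU_eq0
  (hausdorff_set1 0 (x + (a + d) *: u)) (hausdorff_set1 0 (x + (b + d) *: u)))).
move=> y [[/lineP[r Sr ->] h]|[[_ /lineP[t Kt ->] <-] h]].
  exfalso; apply: h; exists (x + (r - d) *: u); last by rewrite -addrA -scalerDl subrK.
  apply/lineP; exists (r - d) => //; apply/Kab.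
  by apply: (shaken_chord_sub u1 hphi xu _ Sr) => s /Kab.
have {}h : ~ (a < t < b).
  move=> tab; apply: h; apply/lineP; exists (t + d); last by rewrite scalerDl addrA.
  by apply: (shaken_chord_sup u1 xu Ki); rewrite -/d addrK.
have /andP[ta tb] := (Kab t).1 Kt.
rewrite /setU /=; rewrite -addrA -scalerDl.
have [<-|at_] := eqVneq a t; first by left.
have [->|bt] := eqVneq t b; first by right.
by exfalso; apply: h; rewrite !lt_neqAle at_ bt ta tb.
Qed.

(** Shaking preserves the length of almost every chord. *)
Lemma hausdorff_shaken K : convex_body K -> hausdorff n.+2 (shaken u phi K) = hausdorff n.+2 K.
Proof.
move=> cK; have [/compact_enormP[clK _] _ _] := cK.
have mS := open_borel (@open_shaken R n.+2 u phi K); have mK := closed_borel clK.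
apply: (hausdorff_eq_sections u1 mS mK (hausdorff_tangent_feet u1 cK)) => x xu xK.
have mSx := measurable_line_section u1 x mS.
have mKx := measurable_line_section u1 x mK.
have [Kx|Kx] := pselect (exists t, K (x + t *: u)); last first.
  have -> : line_section u (shaken u phi K) x = set0.
    apply/seteqP; split=> // r Sr; apply: Kx.
    by have [t [Kt _]] := shaken_sub u1 xu Sr; exists (t + (r - phi t)).
  have -> // : line_section u K x = set0.
  by apply/seteqP; split=> // t Kt; apply: Kx; exists t.
have Kx0 : exists s, K° (x + s *: u) by apply: contrapT => h; apply: xK.
have [a [b [ab Kab _ /(_ Kx0)[ab' Ki]]]] := chord_spec u1 cK xu Kx.
have KxE : line_section u K x = `[a, b]%classic.
  by apply/seteqP; split=> t; rewrite /= in_itv/= => /Kab.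
rewrite KxE lebesgue_measure_itv /= lte_fin ab' -EFinB.
set d := phi ((a + b) / 2) - (a + b) / 2.
apply/eqP; rewrite eq_le; apply/andP; split.
  apply: (@le_trans _ _ (leb `[a + d, b + d]%classic)).
    apply: le_measure; [by rewrite inE|by rewrite inE; exact: measurable_itv|].
    move=> r Sr; have := shaken_chord_sub u1 hphi xu (fun s => (Kab s).1) Sr.
    by rewrite -/d /= in_itv/= => /andP[h1 h2]; apply/andP; split; lra.
  by rewrite lebesgue_measure_itv /= lte_fin ltrD2r ab' -EFinB lee_fin; lra.
apply: (@le_trans _ _ (leb `]a + d, b + d[%classic)).
  by rewrite lebesgue_measure_itv /= lte_fin ltrD2r ab' -EFinB lee_fin; lra.
apply: le_measure; [by rewrite inE; exact: measurable_itv|by rewrite inE|].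
move=> r; rewrite /= in_itv/= => /andP[h1 h2].
by apply: (shaken_chord_sup u1 xu Ki); rewrite -/d; apply/andP; split; lra.
Qed.

Lemma caratheodory_setY A B : (hausdorff n.+2).-caratheodory A ->
  (hausdorff n.+2).-caratheodory B -> (hausdorff n.+2).-caratheodory (A `+` B).
Proof.
move=> cA cB; apply: caratheodory_measurable_setU; exact: caratheodory_measurable_setD.
Qed.

(** Off the tangent feet the section of the shaken body is essentially the
    shifted chord, and a measurable set is null iff almost all its sections
    along [u] are. *)
Lemma ess_eq_shakenP K A : convex_body K -> finite_measurable A ->
  ess_eq A (shaken u phi K) <->
  hausdorff_ae_in n.+1 (perp u)
    (fun x => hausdorff 1 ((A `&` line x) `+` shifted_chord K x) = 0%E).
Proof.
move=> cK [cA Afin].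
have N0 := hausdorff_tangent_feet u1 cK.
(* sections distribute over symmetric differences, which obey the triangle inequality *)
have tri x (P Q S : set 'rV[R]_n.+2) : hausdorff 1 (P `+` Q) = 0%E ->
    hausdorff 1 (Q `+` S) = 0%E -> hausdorff 1 (P `+` S) = 0%E.
  move=> h1 h2; apply: hausdorff_subset_eq0 (hausdorff_setU_eq0 h1 h2) => y.
  have [Qy|Qy] := pselect (Q y).
    by case=> [[Py Sy]|[Sy Py]]; [right; left|left; right].
  by case=> [[Py Sy]|[Sy Py]]; [left; left|right; right].
split=> [h|h].
  have hs := hausdorff_null_sections u1 h.
  apply: hausdorff_subset_eq0 (hausdorff_setU_eq0 hs N0) => x [xu hx].
  have [xK|xK] := pselect (tangent_feet u K x); [by right|left; split=> // h0; apply: hx].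
  apply: (tri x _ (shaken u phi K `&` line x)); last exact: shifted_chord_section.
  by rewrite -setIYl.
apply: (hausdorff_null_of_sections u1).
- apply: caratheodory_setY => //; apply: open_caratheodory; exact: open_shaken.
- apply: le_lt_trans (hausdorff_setU_le _ _ _) _.
  apply: (@le_lt_trans _ _ (hausdorff n.+2 A + hausdorff n.+2 (shaken u phi K))%E).
    by apply: leeD; apply: le_hausdorff => y [].
  by rewrite lte_add_pinfty// hausdorff_shaken// convex_body_fin.
- apply: hausdorff_subset_eq0 (hausdorff_setU_eq0 h N0) => x [xu hx].
  have [xK|xK] := pselect (tangent_feet u K x); [by right|left; split=> // h0; apply: hx].
  rewrite setIYl; apply: (tri x _ _ _ h0).
  by rewrite setYC; exact: shifted_chord_section.
Qed.

End ShakenMeasure.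

(** * Set maps and the shaken body *)

Section Slabs.
Context {R : realType} {n : nat}.
Variable u : 'rV[R]_n.+2.
Hypothesis u1 : enorm u = 1.
Implicit Types (A B K L : set 'rV[R]_n.+2) (x y z c v : 'rV[R]_n.+2) (a b s t r d : R).

Lemma cylinderP x r y : cylinder u x r y <-> enorm (hproj u y - x) <= r.
Proof.
split=> [[w [wx wu] [_ [t _ <-] <-]]|h].
  by rewrite hproj_perp_shift.
exists (hproj u y); first by split=> //; exact: dot_hproj.
by exists (dot y u *: u); [exists (dot y u)|exact: hprojK].
Qed.

Lemma closed_cylinder x r : closed (cylinder u x r).
Proof.
have -> : cylinder u x r = hproj u @^-1` eball x r.
  by apply/seteqP; split=> y /cylinderP.
by apply: closed_comp; [move=> y _; exact: hproj_continuous|exact: closed_eball].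
Qed.

Definition slab x d a b : set 'rV[R]_n.+2 :=
  [set y | enorm (hproj u y - x) <= d /\ a <= dot y u <= b].

Lemma hausdorff_slab x d a b : a <= b ->
  hausdorff n.+2 (slab x d a b) = (base_measure u1 (eball x d) * (b - a)%:E)%E.
Proof.
move=> ab.
have -> : slab x d a b = split_line u @^-1` (eball x d `*` `[a, b]%classic).
  by apply/seteqP; split=> y [h]; rewrite /= ?in_itv/= => h'; split=> //; rewrite /= in_itv.
rewrite -split_measureE split_measure_rect//; last first.
  by apply: closed_borel; exact: closed_eball.
congr (_ * _)%E; rewrite lebesgue_measure_itv /= lte_fin.
have [//|ba] := ltP a b; have -> : a = b by apply/eqP; rewrite eq_le ab.
by rewrite subrr.
Qed.

Lemma slab_sub_eball x d t h r : perp u x -> 0 <= r -> d ^+ 2 + h ^+ 2 <= r ^+ 2 ->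
  slab x d (t - h) (t + h) `<=` eball (x + t *: u) r.
Proof.
move=> xu r0 dh y [yx /andP[y1 y2]]; rewrite /eball /=.
have -> : y - (x + t *: u) = (hproj u y - x) + (dot y u - t) *: u.
  by rewrite -{1}(hprojK u y); apply/rowP => i; rewrite !mxE; ring.
rewrite -ler_sqr ?nnegrE ?enorm_ge0// sqr_enorm_shift//; last first.
  by rewrite /perp /= dotBl dot_hproj// xu subrr.
apply: le_trans dh; apply: lerD.
  by rewrite ler_sqr ?nnegrE ?enorm_ge0// (le_trans _ yx)// enorm_ge0.
rewrite -[leLHS]real_normK ?num_real// ler_sqr ?nnegrE//.
  by rewrite ler_norml; apply/andP; split; lra.
by lra.
Qed.

Lemma eball_slab x d t : perp u x -> eball (x + t *: u) d `<=` slab x d (t - d) (t + d).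
Proof.
move=> xu y yx; split.
  by rewrite -(hproj_perp_shift u1 t xu) -hprojB; apply: le_trans (enorm_hproj_le u1 _) yx.
have := le_trans (dot_le_enorm u1 _) yx; rewrite dotBl dot_perp_shift//.
by rewrite ler_norml => /andP[h1 h2]; apply/andP; split; lra.
Qed.

Lemma convex_body_slab x d t h : perp u x -> 0 < d -> 0 < h ->
  convex_body (slab x d (t - h) (t + h)).
Proof.
move=> xu d0 h0; split.
- apply/compact_enormP; split.
    have -> : slab x d (t - h) (t + h) = cylinder u x d `&`
        (fun y => dot y u) @^-1` `[t - h, t + h]%classic.
      by apply/seteqP; split=> y []; rewrite /= ?in_itv/= => /cylinderP h1 h2; split=> //;
        rewrite /= in_itv.
    apply: closedI; first exact: closed_cylinder.
    by apply: closed_comp; [move=> y _; exact: dot_continuous|exact: itv_closed].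
  exists (Num.sqrt (d ^+ 2 + h ^+ 2) + enorm (x + t *: u)) => y yS.
  have r0 : 0 <= Num.sqrt (d ^+ 2 + h ^+ 2) by exact: sqrtr_ge0.
  have rE : d ^+ 2 + h ^+ 2 <= Num.sqrt (d ^+ 2 + h ^+ 2) ^+ 2.
    by rewrite sqr_sqrtr// addr_ge0 ?sqr_ge0.
  have := slab_sub_eball xu r0 rE yS; rewrite /eball /= subr0 => yx.
  have := ler_enormD (y - (x + t *: u)) (x + t *: u); rewrite subrK => /le_trans; apply.
  by rewrite lerD2r.
- apply/convex_combP => y z s [y1 /andP[y2 y3]] [z1 /andP[z2 z3]] /andP[s0 s1]; split.
    have -> : hproj u (s *: y + (1 - s) *: z) - x =
        s *: (hproj u y - x) + (1 - s) *: (hproj u z - x).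
      by rewrite /hproj dotDl !dotZl; apply/rowP => i; rewrite !mxE; ring.
    apply: le_trans (ler_enormD _ _) _; rewrite !enormZ !ger0_norm ?subr_ge0//.
    have -> : d = s * d + (1 - s) * d by ring.
    by apply: lerD; rewrite ler_wpM2l ?subr_ge0.
  rewrite dotDl !dotZl; have s10 : 0 <= 1 - s by rewrite subr_ge0.
  have := ler_wpM2l s0 y2; have := ler_wpM2l s0 y3.
  have := ler_wpM2l s10 z2; have := ler_wpM2l s10 z3.
  by move=> *; apply/andP; split; lra.
- exists (x + t *: u); apply/interior_enormP; exists (Num.min d h).
    by rewrite lt_min d0.
  move=> y yx; have [yd yh] := eball_slab xu yx.
  split; first by rewrite (le_trans yd)// ge_min lexx.
  have : Num.min d h <= h by rewrite ge_min lexx orbT.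
  by move: yh => /andP[h1 h2] h3; apply/andP; split; lra.
Qed.

(** The cylinder of height [d] over the base lies in a ball of radius [2d]. *)
Lemma base_measure_eball_le x d : perp u x -> 0 < d ->
  (base_measure u1 (eball x d) <=
    (2 ^+ n.+2 * d ^+ n.+1 * fine (hausdorff n.+2 (eball (0 : 'rV[R]_n.+2) 1)))%:E)%E.
Proof.
move=> xu d0.
have fE : hausdorff n.+2 (eball (0 : 'rV[R]_n.+2) 1) =
    (fine (hausdorff n.+2 (eball (0 : 'rV[R]_n.+2) 1)))%:E.
  by rewrite fineK// ge0_fin_numE ?hausdorff_ge0// hausdorff_eball_fin.
set c := fine _ in fE *.
have d20 : 0 < 2 * d by rewrite mulr_gt0.
have : (base_measure u1 (eball x d) * d%:E <= ((2 * d) ^+ n.+2 * c)%:E)%E.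
  have -> : (base_measure u1 (eball x d) * d%:E)%E = hausdorff n.+2 (slab x d 0 d).
    by rewrite hausdorff_slab ?ltW// subr0.
  rewrite EFinM -fE.
  apply: le_trans (hausdorff_eball_le x d20); apply: le_hausdorff => y [yx /andP[y0 y1]].
  rewrite /eball /= -(hprojK u y) addrAC; apply: le_trans (ler_enormD _ _) _.
  by rewrite enormZ u1 mulr1 ger0_norm// mulr_natl; apply: lerD.
rewrite -lee_pdivlMr// -EFinM => /le_trans; apply; rewrite lee_fin.
rewrite ler_pdivrMr// exprMn [d ^+ n.+2]exprSr.
by move: (2 ^+ n.+2) (d ^+ n.+1) => p q; rewrite le_eqVlt; apply/orP; left; apply/eqP; ring.
Qed.

End Slabs.

Section Characterization.
Context {R : realType} {n : nat}.
Variable u : 'rV[R]_n.+2.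
Hypothesis u1 : enorm u = 1.
Variable phi : R -> R.
Hypothesis hphi : 1.-lipschitz phi.
Variable D : set 'rV[R]_n.+2 -> set 'rV[R]_n.+2.
Hypothesis hD : forall K, convex_body K -> finite_measurable (D K).
Implicit Types (A B K L : set 'rV[R]_n.+2) (x y z c v : 'rV[R]_n.+2) (a b s t r d : R).

(** Since [phi] is a contraction, the distance from a point of the shaken ball to
    the new centre is at most the larger of the distances from the old centre to
    the two points of the ball that witness it; equal volumes do the rest. *)
Lemma shaken_eball x t r : 0 < r -> perp u x ->
  ess_eq (shaken u phi (eball (x + t *: u) r)) (eball (x + phi t *: u) r).
Proof.
move=> r0 xu; have cB := convex_body_eball (x + t *: u) r0.
apply: ess_eq_of_sub.
- by apply: open_caratheodory; exact: open_shaken.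
- by apply: borel_caratheodory; apply: closed_borel; exact: closed_eball.
- by rewrite hausdorff_shaken// convex_body_fin.
- rewrite (hausdorff_shaken u1 hphi cB); exact: hausdorff_eball_shift.
apply: subset_ess_sub => y.
have yE := hprojK u y; set w := hproj u y in yE; set q := dot y u in yE.
have wu : perp u w by exact: dot_hproj.
rewrite -yE => /(shaken_sub u1 wu)[s [K1 K2]].
have E p p' : w + p *: u - (x + p' *: u) = (w - x) + (p - p') *: u.
  by apply/rowP => i; rewrite !mxE; ring.
have wxu : perp u (w - x) by rewrite /perp /= dotBl wu xu subrr.
move: K1 K2; rewrite /eball /= !E -![enorm _ <= r]ler_sqr ?nnegrE ?enorm_ge0 ?(ltW r0)//.
rewrite !sqr_enorm_shift//.
have := contraction_le hphi s t; set e := enorm _ ^+ 2.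
(* the inequality for heights: p is the height of the point above phi s, and
   g and m are the differences phi s - phi t and s - t *)
have : forall p g m : R, `|g| <= `|m| ->
    (p + g) ^+ 2 <= Num.max ((m + p) ^+ 2) ((m - p) ^+ 2).
  move=> p g m gm; rewrite le_max.
  have [p0|p0] := leP 0 (p * m); apply/orP; [left|right].
    rewrite [m + p]addrC -subr_ge0.
    have g2 : g ^+ 2 <= m ^+ 2.
      by rewrite -[g ^+ 2]real_normK ?num_real// -[m ^+ 2]real_normK ?num_real// ler_sqr ?nnegrE.
    have pg : p * g <= p * m.
      apply: le_trans (ler_norm _) _; rewrite normrM.
      by rewrite -[leRHS]ger0_norm// normrM ler_wpM2l.
    by rewrite !sqrrD; lra.
  have g2 : g ^+ 2 <= m ^+ 2.
    by rewrite -[g ^+ 2]real_normK ?num_real// -[m ^+ 2]real_normK ?num_real// ler_sqr ?nnegrE.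
  have pg : p * g <= - (p * m).
    apply: le_trans (ler_norm _) _; rewrite normrM.
    by rewrite -[leRHS]gtr0_norm ?oppr_gt0// normrN normrM ler_wpM2l.
  by rewrite !(sqrrD, sqrrB); lra.
move=> key h K1 K2.
have := key (q - phi s) (phi s - phi t) (s - t) h.
have -> : q - phi s + (phi s - phi t) = q - phi t by ring.
have -> : s - t + (q - phi s) = s + (q - phi s) - t by ring.
have -> : s - t - (q - phi s) = s - (q - phi s) - t by ring.
by rewrite le_max => /orP[] h'; lra.
Qed.

(** Each property is inherited from the shaken body, once essential inclusions
    between convex bodies and closed sets are turned into inclusions. *)
Lemma properties_of_shaken :
  (forall K, convex_body K -> ess_eq (D K) (shaken u phi K)) ->
  [/\ monotonic_on convex_body D,
      measure_preserving_on convex_body D,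
      respects_cylinders_on convex_body u D,
      maps_balls_to_balls_on convex_body D
    & forall (r : R) x t, 0 < r -> perp u x ->
        ess_eq (D (eball (x + t *: u) r)) (eball (x + phi t *: u) r)].
Proof.
move=> DS.
have balls (r : R) x t : 0 < r -> perp u x ->
    ess_eq (D (eball (x + t *: u) r)) (eball (x + phi t *: u) r).
  move=> r0 xu; apply: ess_eq_trans (DS _ (convex_body_eball _ r0)) _.
  exact: shaken_eball.
split=> //.
- move=> K L cK cL KL; have [/compact_enormP[clL _] _ _] := cL.
  have /shaken_mono SKL := convex_body_ess_sub cK clL KL.
  have [h1 _] := (ess_eqP _ _).1 (DS _ cK); have [_ h2] := (ess_eqP _ _).1 (DS _ cL).
  apply: ess_sub_trans h1 _; apply: ess_sub_trans h2; apply: subset_ess_sub.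
  exact: SKL.
- by move=> K cK; rewrite (ess_eq_hausdorff (DS _ cK)) hausdorff_shaken.
- move=> K x r cK r0 Kx; have [h1 _] := (ess_eqP _ _).1 (DS _ cK).
  have KC := convex_body_ess_sub cK (@closed_cylinder R n u u1 x r) Kx.
  apply: ess_sub_trans h1 _; apply: subset_ess_sub => y.
  have yE := hprojK u y; have yu := dot_hproj u1 y.
  rewrite -{1}yE => /(shaken_sub u1 yu)[t [/KC/(cylinderP u1) h _]].
  by apply/(cylinderP u1); move: h; rewrite hproj_perp_shift.
- move=> K x r cK r0 Kx.
  have [h1 h2] := (ess_eqP _ _).1 Kx.
  have [/compact_enormP[clK _] _ _] := cK.
  (* a convex body that is essentially a ball is that ball *)
  have -> : K = eball x r.
    apply/seteqP; split; first exact: convex_body_ess_sub cK (@closed_eball _ _ _ _) h1.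
    exact: convex_body_ess_sub (convex_body_eball x r0) clK h2.
  exists (hproj u x + phi (dot x u) *: u), r; split=> //.
  by rewrite -{1}(hprojK u x); apply: balls => //; exact: dot_hproj.
Qed.

(** The density estimate.  Around the axis through a point [p] of the shaken body
    there is a thin cylinder [L] of radius [d], half-height [h] and centre
    [x + t u] inside [K].  It lies in the ball of radius [r = sqrt (d^2 + h^2)]
    with the same centre, hence [D L] lies in the cylinder [C] of radius [d] and
    half-height [r] around [x + phi t u].  Since [D L] has the volume of [L], it
    misses only a part of [C] of relative size [(r - h) / h], which is of order
    [d^2]; and [C] contains the ball of radius [d] around [p]. *)
Lemma shaken_density K p : convex_body K ->
  [/\ monotonic_on convex_body D,
      measure_preserving_on convex_body D,
      respects_cylinders_on convex_body u D
    & forall (r : R) x t, 0 < r -> perp u x ->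
        ess_eq (D (eball (x + t *: u) r)) (eball (x + phi t *: u) r)] ->
  shaken u phi K p ->
  exists C r : R, 0 < r /\ forall d, 0 < d <= r ->
    (hausdorff n.+2 (eball p d `\` D K) <= (C * d ^+ n.+3)%:E)%E.
Proof.
move=> cK [Dmono Dmeas Dcyl Dball] [t _ /interior_enormP[r0 r00 sub]].
pose x := hproj u p; have xu : perp u x by exact: dot_hproj.
pose s := dot p u - phi t.
have pE : p = x + (phi t + s) *: u.
  by rewrite /x /s [phi t + _]addrC subrK hprojK.
pose e := r0 / 2; have e0 : 0 < e by rewrite divr_gt0.
pose h := `|s| + e; have h0 : 0 < h by rewrite ltr_wpDl.
have Kt w : perp u w -> enorm (w - x) <= e ->
    K (w + (t + h) *: u) /\ K (w + (t - h) *: u).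
  move=> wu wx.
  (* the one of the points w + h u, w - h u that is close to p - phi(t) u *)
  pose g := if 0 <= s then h else - h.
  have gs : `|g - s| <= e.
    rewrite /g /h; have [s0|s0] := leP 0 s.
      by rewrite (ger0_norm s0) addrAC subrr add0r gtr0_norm.
    by rewrite (ltr0_norm s0) opprD opprK addrAC subrr add0r normrN gtr0_norm.
  have [|z zK zE] := sub (w + (phi t + g) *: u).
    rewrite /eball /= pE.
    have -> : w + (phi t + g) *: u - (x + (phi t + s) *: u) = (w - x) + (g - s) *: u.
      by apply/rowP => i; rewrite !mxE; ring.
    apply: le_trans (ler_enormD _ _) _; rewrite enormZ u1 mulr1.
    by rewrite /e in wx gs; lra.
  have : reflected_section K u t (w + g *: u).
    suff -> : w + g *: u = z by [].
    by rewrite scalerDl addrA addrAC in zE; exact/esym/(addIr _ zE).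
  move=> /(reflected_section_line u1 _ _ _ wu); rewrite /g.
  by case: ifP => _ []; rewrite ?opprK.
have LK d : d <= e -> slab u x d (t - h) (t + h) `<=` K.
  move=> de y [yx ty]; rewrite -(hprojK u y).
  have [K1 K2] := Kt _ (dot_hproj u1 y) (le_trans yx de).
  by have [_ cvK _] := cK; exact: line_between cvK ty K2 K1.
pose c := fine (hausdorff n.+2 (eball (0 : 'rV[R]_n.+2) 1)).
have c0 : 0 <= c by rewrite fine_ge0// hausdorff_ge0.
exists (2 ^+ n.+2 * c * (2 / h)), e; split=> // d /andP[d0 de].
pose L := slab u x d (t - h) (t + h).
have cL : convex_body L by exact: convex_body_slab.
pose r := Num.sqrt (d ^+ 2 + h ^+ 2).
have rE : r ^+ 2 = d ^+ 2 + h ^+ 2 by rewrite sqr_sqrtr// addr_ge0 ?sqr_ge0.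
have r_ge0 : 0 <= r by exact: sqrtr_ge0.
have hr : h < r.
  by rewrite -ltr_sqr ?nnegrE ?(ltW h0)// rE ltrDr exprn_gt0.
have r_gt0 : 0 < r by exact: lt_trans hr.
pose C := slab u x d (phi t - r) (phi t + r).
have LB : L `<=` eball (x + t *: u) r by apply: slab_sub_eball => //; rewrite rE.
have DLC : ess_sub (D L) C.
  have h1 : ess_sub (D L) (cylinder u x d).
    by apply: Dcyl => //; apply: subset_ess_sub => y [yx _]; apply/cylinderP.
  have h2 : ess_sub (D L) (eball (x + phi t *: u) r).
    have [h3 _] := (ess_eqP _ _).1 (Dball r x t r_gt0 xu).
    apply: ess_sub_trans h3; apply: Dmono => //; first exact: convex_body_eball.
    exact: subset_ess_sub.
  apply: hausdorff_subset_eq0 (hausdorff_setU_eq0 h1 h2) => y [Dy Cy].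
  have [y1|y1] := pselect (cylinder u x d y); last by left.
  right; split=> // /(eball_slab u1 xu)[_ y2]; apply: Cy; split=> //.
  exact/(cylinderP u1).
have DLK : ess_sub (D L) (D K).
  by apply: Dmono => //; apply: subset_ess_sub; exact: LK.
have [cDL DLfin] := hD cL.
have cut : (hausdorff n.+2 (C `\` D L) <= hausdorff n.+2 C - hausdorff n.+2 L)%E.
  have Lfin : hausdorff n.+2 L \is a fin_num.
    by rewrite ge0_fin_numE ?hausdorff_ge0// convex_body_fin.
  rewrite leeBrDr// (cDL C) -setDE addeC; apply: leeD => //.
  rewrite -(Dmeas _ cL); apply: hausdorff_le_of_setD_eq0.
  by apply: hausdorff_subset_eq0 DLC => y [Dy Cy]; split=> // Cy'; exact: Cy.
have cover : eball p d `\` D K `<=` (C `\` D L) `|` (D L `\` D K).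
  move=> y [yp Ky]; have [Ly|Ly] := pselect (D L y); [by right|left; split=> //].
  rewrite pE in yp; have [y1 /andP[y2 y3]] := eball_slab u1 xu yp; split=> //.
  have : s <= `|s| by exact: ler_norm.
  have : - s <= `|s| by rewrite -normrN; exact: ler_norm.
  by move=> s1 s2; move: hr; rewrite /h => hr; apply/andP; split; lra.
apply: le_trans (le_hausdorff _ cover) _; apply: le_trans (hausdorff_setU_le _ _ _) _.
rewrite [X in (_ + X)%E]DLK adde0; apply: le_trans cut _.
have bE := base_measure_eball_le u1 xu d0; rewrite -/c in bE.
have bfin : base_measure u1 (eball x d) = (fine (base_measure u1 (eball x d)))%:E.
  by rewrite fineK// ge0_fin_numE//; apply: le_lt_trans bE _; rewrite ltry.
rewrite /C /L !(hausdorff_slab u1); [|by lra|by lra].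
rewrite bfin -!EFinM -EFinB lee_fin; rewrite bfin lee_fin in bE.
set b := fine _ in bE *.
have b0 : 0 <= b by rewrite fine_ge0.
have -> : b * (phi t + r - (phi t - r)) - b * (t + h - (t - h)) = b * (2 * (r - h)) by ring.
have rh : r - h <= d ^+ 2 / h.
  have rh0 : 0 < r - h by rewrite subr_gt0.
  rewrite ler_pdivlMr//; have : (r - h) * (r + h) = d ^+ 2 by rewrite -subr_sqr rE addrK.
  by move=> <-; apply: ler_wpM2l; [exact: ltW|rewrite lerDr].
apply: (@le_trans _ _ ((2 ^+ n.+2 * d ^+ n.+1 * c) * (2 * (d ^+ 2 / h)))).
  apply: ler_pM => //; first by rewrite mulr_ge0// subr_ge0 ltW.
  by rewrite ler_wpM2l.
rewrite [d ^+ n.+3]exprSr [d ^+ n.+2]exprSr; move: (2 ^+ n.+2) (d ^+ n.+1) => q1 q2.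
by rewrite le_eqVlt; apply/orP; left; apply/eqP; ring.
Qed.

(** The shaken body lies in [D K] essentially, by the density estimate, and both
    have the measure of [K]. *)
Lemma shaken_of_properties :
  [/\ monotonic_on convex_body D,
      measure_preserving_on convex_body D,
      respects_cylinders_on convex_body u D
    & forall (r : R) x t, 0 < r -> perp u x ->
        ess_eq (D (eball (x + t *: u) r)) (eball (x + phi t *: u) r)] ->
  forall K, convex_body K -> ess_eq (D K) (shaken u phi K).
Proof.
move=> props K cK; have [cDK DKfin] := hD cK; have [_ Dmeas _ _] := props.
have Sfin : (hausdorff n.+2 (shaken u phi K) < +oo)%E.
  by rewrite hausdorff_shaken// convex_body_fin.
apply: ess_eq_sym; apply: ess_eq_of_sub => //.
- by apply: open_caratheodory; exact: open_shaken.
- by rewrite hausdorff_shaken// Dmeas.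
apply: hausdorff_setD_eq0 Sfin _ => p Sp; exact: shaken_density cK props Sp.
Qed.

End Characterization.

Theorem theorem6p6 (R : realType) (n : nat) (hn : (2 <= n)%N)
    (u : 'rV[R]_n) (hu : unit_sphere u)
    (D : set 'rV[R]_n -> set 'rV[R]_n)
    (hD : forall K, convex_body K -> finite_measurable (D K))
    (phi : R -> R) (hphi : 1.-lipschitz phi) :
  [<->
    [/\ monotonic_on convex_body D,
        measure_preserving_on convex_body D,
        respects_cylinders_on convex_body u D,
        maps_balls_to_balls_on convex_body D
      & forall (r : R) (x : 'rV[R]_n) (t : R), 0 < r -> perp u x ->
          ess_eq (D (eball (x + t *: u) r)) (eball (x + phi t *: u) r)];
    forall K, convex_body K ->
      ess_eq (D K)
        (\bigcup_(t : R)
          (translate (reflected_section K u t) (phi t *: u))°);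
    forall K, convex_body K ->
      hausdorff_ae_in n.-1 (perp u) (fun x =>
        hausdorff 1
          ((D K `&` translate (axis u) x) `+`
           translate (K `&` translate (axis u) x)
             ((phi (chord_mid K u x) - chord_mid K u x) *: u)) = 0%E)].
Proof.
case: n hn u hu D hD => [//|[//|n]] _ u u1 D hD.
tfae.
- by move=> [h1 h2 h3 _ h5]; apply: shaken_of_properties.
- by move=> h K cK; apply/(ess_eq_shakenP u1 hphi cK (hD _ cK)); exact: h.
- move=> h; apply: properties_of_shaken => // K cK.
  by apply/(ess_eq_shakenP u1 hphi cK (hD _ cK)); exact: h.
Qed.
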